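(* Let $G$ be either a Hantzsche-Wendt group or a Bieberbach group of diagonal type with holonomy group isomorphic to $C_2^2$. Then $G$ satisfies the Unit Conjecture over the field $\mathbb{F}_2$ if and only if $G$ is poly-$\mathbb{Z}$.
   Context: An $n$-dimensional crystallographic group is a discrete cocompact subgroup $\Gamma$ of $\mathrm{Isom}(\mathbb{E}^n)=O(n)\ltimes\mathbb{R}^n$. Its lattice subgroup is $\Gamma\cap\mathbb{R}^n\cong\mathbb{Z}^n$; its holonomy group is the finite group $\Gamma/(\Gamma\cap\mathbb{R}^n)$, and the conjugation action of the holonomy group on the lattice subgroup is the (faithful) holonomy representation. A Bieberbach group is a torsion-free crystallographic group. A crystallographic group is of diagonal type if it is isomorphic to a crystallographic group whose holonomy representation is diagonal (equivalently, the lattice subgroup has a $\mathbb{Z}$-basis $e_1,\dots,e_n$ with $g\cdot e_i=\pm e_i$ for all holonomy elements $g$ and all $i$). A Hantzsche-Wendt group is the fundamental group of an oriented $n$-dimensional closed flat manifold with holonomy group isomorphic to $C_2^{n-1}$; i.e. an $n$-dimensional Bieberbach group with holonomy group isomorphic to $C_2^{n-1}$ all of whose elements are orientation preserving. A torsion-free group $G$ satisfies the Unit Conjecture over a field $K$ if every unit of the group ring $K[G]$ is trivial, i.e. of the form $\lambda g$ with $\lambda\in K\smallsetminus\{0\}$ and $g\in G$. A group is poly-$\mathbb{Z}$ if it has a (finite) normal series whose factor groups are isomorphic to $\mathbb{Z}$. *)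

(* Defs.v *)
From HB Require Import structures.
From mathcomp Require Import all_boot all_order all_algebra.
From mathcomp Require Import finmap.
From mathcomp Require Import all_classical all_reals all_analysis.

Set Implicit Arguments.
Unset Strict Implicit.
Unset Printing Implicit Defensive.

Import GRing.Theory Num.Theory.
Import numFieldNormedType.Exports.

Local Open Scope classical_set_scope.
Local Open Scope ring_scope.

Definition subgroup_type (G : groupType) (H : groupClosed G) : Type :=
  {x : G | x \in H}.

Section SubgroupType.
Variables (G : groupType) (H : groupClosed G).

HB.instance Definition _ := [isSub of subgroup_type H for @sval G _].
HB.instance Definition _ := [Choice of subgroup_type H by <:].

Fact subgroup_type_closed : group_closed H.
Proof. by split; [exact: gpred1 | exact: gpredF]. Qed.

HB.instance Definition _ := SubChoice_isSubGroup.Build G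
  (fun x : G => x \in H) (subgroup_type H) subgroup_type_closed.

End SubgroupType.

Definition isomorphic (G H : groupType) :=
  exists f : Multiplicative.type G H, bijective f.

Definition torsion_free (G : groupType) :=
  forall (x : G) (k : nat), (0 < k)%N -> (x ^+ k = 1)%g -> x = 1%g.

Section Cosets.
Variable G : groupType.
Implicit Types A N C D : set G.

Definition prod_set C D : set G := [set (x * y)%g | x in C & y in D].

Definition left_coset (x : G) N : set G := [set (x * y)%g | y in N].

Definition left_cosets A N : set (set G) := [set left_coset x N | x in A].

(* For N a normal subgroup of A, the quotient group A / N, i.e. the cosets of
   N in A under the product of subsets, is isomorphic to the additive group
   V. *)
Definition quotient_isog A N (V : zmodType) :=
  exists phi : set G -> V,
    set_bij (left_cosets A N) [set: V] phi /\
    {in left_cosets A N &, forall C D, phi (prod_set C D) = phi C + phi D}.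

End Cosets.

Definition normal_in (G : groupType) (N A : groupClosed G) :=
  {subset N <= A} /\ forall x y, x \in A -> y \in N -> (y ^ x)%g \in N.

(* The terms of the series need only be normal in the preceding term. *)
Definition poly_Z (G : groupType) :=
  exists (m : nat) (S : nat -> groupClosed G),
    [/\ S 0%N =i predT, S m =i pred1 1%g &
        forall i, (i < m)%N -> normal_in (S i.+1) (S i) /\
          quotient_isog [set` S i] [set` S i.+1] int].

Section CosetSpace.
Variables (G : groupType) (H : groupClosed G).

Definition coset_rel : rel G := fun x y => (x^-1 * y)%g \in H.

Fact coset_rel_refl : reflexive coset_rel.
Proof. by move=> x; rewrite /coset_rel mulVg gpred1. Qed.

Fact coset_rel_sym : symmetric coset_rel.
Proof. by move=> x y; rewrite /coset_rel -gpredV invgM invgK. Qed.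

Fact coset_rel_trans : transitive coset_rel.
Proof.
move=> y x z xy yz; rewrite /coset_rel.
have -> : (x^-1 * z = (x^-1 * y) * (y^-1 * z))%g by rewrite mulgA mulgK.
exact: gpredM.
Qed.

Canonical coset_equiv :=
  EquivRel coset_rel coset_rel_refl coset_rel_sym coset_rel_trans.

Definition coset_space := {eq_quot coset_equiv}%qT.

HB.instance Definition _ := Quotient.on coset_space.

End CosetSpace.

Section GroupRing.
Variables (K : nzRingType) (G : groupType).

Definition group_ring : Type := {fsfun G -> K with 0}.

HB.instance Definition _ := Choice.on group_ring.

Implicit Types f g h : {fsfun G -> K with 0}.

Local Open Scope fset_scope.
Local Open Scope ring_scope.

Definition gr_zero : group_ring := [fsfun].

Definition gr_opp f : group_ring := [fsfun x in finsupp f => - f x].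

Definition gr_add f g : group_ring :=
  [fsfun x in finsupp f `|` finsupp g => f x + g x].

Definition gr_monomial (a : K) (x : G) : group_ring := [fsfun y in [fset x] => a].

Definition gr_mul f g : group_ring :=
  [fsfun x in [fset (y * z)%g | y in finsupp f, z in finsupp g] =>
     \sum_(y <- finsupp f) f y * g (y^-1 * x)%g].

Fact gr_zeroE x : (gr_zero : {fsfun G -> K with 0}) x = 0.
Proof. by rewrite fsfunE. Qed.

Fact gr_oppE f x : (gr_opp f : {fsfun G -> K with 0}) x = - f x.
Proof. by rewrite fsfunE; case: finsuppP; rewrite ?oppr0. Qed.

Fact gr_addE f g x : (gr_add f g : {fsfun G -> K with 0}) x = f x + g x.
Proof.
rewrite fsfunE in_fsetU.
by case: (finsuppP f); case: (finsuppP g); rewrite ?addr0.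
Qed.

Fact gr_monomialE a x y :
  (gr_monomial a x : {fsfun G -> K with 0}) y = if y == x then a else 0.
Proof. by rewrite fsfunE in_fset1. Qed.

Fact gr_mulEw (E : {fset G}) f g x : finsupp f `<=` E ->
  (gr_mul f g : {fsfun G -> K with 0}) x =
    \sum_(y <- E) f y * g (y^-1 * x)%g.
Proof.
move=> fE; rewrite -(big_fset_incl _ fE); last first.
  by move=> y _ /fsfun_dflt ->; rewrite mul0r.
rewrite fsfunE; case: ifPn => // xN; rewrite big_seq big1 // => y yf.
case: (finsuppP g (y^-1 * x)%g) => [|yxg]; first by rewrite mulr0.
case/negP: xN; apply/imfset2P; exists y => //; exists (y^-1 * x)%g => //.
by rewrite mulVKg.
Qed.

Definition gr_mulE f g x := gr_mulEw g x (fsubset_refl (finsupp f)).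

Fact gr_addA : associative gr_add.
Proof. by move=> f g h; apply/fsfunP => x; rewrite !gr_addE addrA. Qed.

Fact gr_addC : commutative gr_add.
Proof. by move=> f g; apply/fsfunP => x; rewrite !gr_addE addrC. Qed.

Fact gr_add0 : left_id gr_zero gr_add.
Proof. by move=> f; apply/fsfunP => x; rewrite gr_addE gr_zeroE add0r. Qed.

Fact gr_addN : left_inverse gr_zero gr_opp gr_add.
Proof.
by move=> f; apply/fsfunP => x; rewrite gr_addE gr_oppE gr_zeroE addNr.
Qed.

HB.instance Definition _ := GRing.isZmodule.Build group_ring
  gr_addA gr_addC gr_add0 gr_addN.

Fact gr_mulA : associative gr_mul.
Proof.
move=> f g h; apply/fsfunP => x; rewrite gr_mulE.
pose E := [fset (y * z)%g | y in finsupp f, z in finsupp g].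
have sE : finsupp (gr_mul f g : {fsfun G -> K with 0}) `<=` E.
  exact: finsupp_sub.
rewrite (gr_mulEw _ _ sE).
under [RHS]eq_bigr do rewrite gr_mulE big_distrl.
rewrite exchange_big /= !big_seq; apply: eq_bigr => y yf.
rewrite gr_mulE big_distrr /=.
pose F := [fset (y * z)%g | z in finsupp g].
have sF : F `<=` E.
  apply/fsubsetP => _ /imfsetP[z /= zg ->].
  by apply/imfset2P; exists y => //; exists z.
rewrite -(big_fset_incl _ sF) /=; last first.
  move=> u _ uF; rewrite [g _]fsfun_dflt ?mulr0 ?mul0r //.
  apply: contra uF => ug; apply/imfsetP; exists (y^-1 * u)%g => //.
  by rewrite mulVKg.
rewrite big_imfset /=; last by move=> z w _ _ /mulgI.
by apply: eq_bigr => z _; rewrite mulKg invgM !mulgA mulrA.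
Qed.

Fact gr_mul1l : left_id (gr_monomial 1 1%g) gr_mul.
Proof.
move=> f; apply/fsfunP => x.
rewrite (@gr_mulEw [fset 1%g]); last exact: finsupp_sub.
by rewrite big_seq_fset1 gr_monomialE eqxx mul1r invg1 mul1g.
Qed.

Fact gr_mul1r : right_id (gr_monomial 1 1%g) gr_mul.
Proof.
move=> f; apply/fsfunP => x.
rewrite (gr_mulEw _ _ (fsubsetUr [fset x] _)).
rewrite (big_fsetD1 x) /=; last by rewrite !inE eqxx.
rewrite gr_monomialE mulVg eqxx mulr1 big_seq big1 ?addr0 // => y.
rewrite in_fsetD1 => /andP[yx _]; rewrite gr_monomialE.
case: eqP => [/(congr1 (fun z => y * z)%g)|_]; last by rewrite mulr0.
by rewrite mulVKg mulg1 => xy; rewrite xy eqxx in yx.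
Qed.

Fact gr_mulDl : left_distributive gr_mul gr_add.
Proof.
move=> f g h; apply/fsfunP => x; rewrite gr_addE.
rewrite (@gr_mulEw (finsupp f `|` finsupp g) (gr_add f g));
  last exact: finsupp_sub.
rewrite (gr_mulEw _ _ (fsubsetUl _ (finsupp g))).
rewrite (gr_mulEw _ _ (fsubsetUr (finsupp f) _)) -big_split /=.
by apply: eq_bigr => y _; rewrite gr_addE mulrDl.
Qed.

Fact gr_mulDr : right_distributive gr_mul gr_add.
Proof.
move=> f g h; apply/fsfunP => x; rewrite gr_addE !gr_mulE -big_split /=.
by apply: eq_bigr => y _; rewrite gr_addE mulrDr.
Qed.

Fact gr_one_neq0 : gr_monomial 1 1%g != 0 :> group_ring.
Proof.
apply/eqP => /fsfunP/(_ 1%g); rewrite gr_monomialE gr_zeroE eqxx.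
by move/eqP; rewrite oner_eq0.
Qed.

HB.instance Definition _ := GRing.Zmodule_isNzRing.Build group_ring
  gr_mulA gr_mul1l gr_mul1r gr_mulDl gr_mulDr gr_one_neq0.

End GroupRing.

Definition is_unit (A : nzRingType) (u : A) :=
  exists v : A, u * v = 1 /\ v * u = 1.

Definition unit_conjecture (K : fieldType) (G : groupType) :=
  forall u : group_ring K G, is_unit u ->
    exists (a : K) (x : G), a != 0 /\ u = gr_monomial a x.

Section EuclideanIsometries.
Variables (R : realType) (n : nat).

(* The semidirect product of O(n) and R^n: the pair (A, a) is the isometry
   x |-> A *m x + a. *)
Record eisom := Eisom {
  eisom_pair : 'M[R]_n * 'cV[R]_n ;
  _ : eisom_pair.1^T *m eisom_pair.1 == 1%:M }.

HB.instance Definition _ := [isSub for eisom_pair].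
HB.instance Definition _ := [Choice of eisom by <:].

Definition linear_part (g : eisom) : 'M[R]_n := (eisom_pair g).1.
Definition translation_part (g : eisom) : 'cV[R]_n := (eisom_pair g).2.

Fact eisom_orthl g : (linear_part g)^T *m linear_part g = 1%:M.
Proof. by apply/eqP; case: g. Qed.

Fact eisom_orthr g : linear_part g *m (linear_part g)^T = 1%:M.
Proof. exact: (mulmx1C (eisom_orthl g)). Qed.

Fact translation_subproof (v : 'cV[R]_n) :
  (1%:M, v).1^T *m (1%:M, v).1 == 1%:M :> 'M[R]_n.
Proof. by rewrite /= trmx1 mulmx1. Qed.

Definition translation (v : 'cV[R]_n) := Eisom (translation_subproof v).

Fact eisom_mul_subproof g h :
  let p := (linear_part g *m linear_part h,
            linear_part g *m translation_part h + translation_part g) in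
  p.1^T *m p.1 == 1%:M.
Proof.
by rewrite /= trmx_mul mulmxA -(mulmxA _ _ (linear_part g)) eisom_orthl mulmx1
           eisom_orthl.
Qed.

Definition eisom_mul g h := Eisom (eisom_mul_subproof g h).

Fact eisom_inv_subproof g :
  let p := ((linear_part g)^T, - ((linear_part g)^T *m translation_part g)) in
  p.1^T *m p.1 == 1%:M.
Proof. by rewrite /= trmxK eisom_orthr. Qed.

Definition eisom_inv g := Eisom (eisom_inv_subproof g).

Fact eisom_mulA : associative eisom_mul.
Proof.
move=> f g h; apply/val_inj; congr pair; rewrite /= ?mulmxA //.
by rewrite mulmxDr mulmxA addrA.
Qed.

Fact eisom_mul1g : left_id (translation 0) eisom_mul.
Proof.
move=> g; apply/val_inj; rewrite /= !mul1mx addr0.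
by rewrite /linear_part /translation_part; case: (eisom_pair g).
Qed.

Fact eisom_mulg1 : right_id (translation 0) eisom_mul.
Proof.
move=> g; apply/val_inj; rewrite /= mulmx1 mulmx0 add0r.
by rewrite /linear_part /translation_part; case: (eisom_pair g).
Qed.

Fact eisom_mulVg : left_inverse (translation 0) eisom_inv eisom_mul.
Proof.
by move=> g; apply/val_inj; rewrite /= eisom_orthl /translation_part /= subrr.
Qed.

Fact eisom_mulgV : right_inverse (translation 0) eisom_inv eisom_mul.
Proof.
move=> g; apply/val_inj.
by rewrite /= mulmxN mulmxA eisom_orthr mul1mx addNr.
Qed.

HB.instance Definition _ := isGroup.Build eisom
  eisom_mulA eisom_mul1g eisom_mulg1 eisom_mulVg eisom_mulgV.

HB.instance Definition _ :=
  Topological.copy eisom (initial_topology eisom_pair).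

End EuclideanIsometries.

Section Crystallographic.
Variables (R : realType) (n : nat).
Implicit Type Gamma : groupClosed (eisom R n).

Definition discrete_subgroup Gamma :=
  [set` Gamma] `<=` isolated [set` Gamma].

Definition cocompact Gamma :=
  compact [set: quotient_topology (coset_space Gamma)].

Definition crystallographic Gamma := discrete_subgroup Gamma /\ cocompact Gamma.

Definition bieberbach Gamma :=
  crystallographic Gamma /\ torsion_free (subgroup_type Gamma).

Definition lattice_subgroup Gamma : set (eisom R n) :=
  [set` Gamma] `&` range (@translation R n).

Definition holonomy_isog Gamma (V : zmodType) :=
  quotient_isog [set` Gamma] (lattice_subgroup Gamma) V.

Definition lattice_basis Gamma (e : 'I_n -> 'cV[R]_n) :=
  (forall i, lattice_subgroup Gamma (translation (e i))) /\
  forall g, lattice_subgroup Gamma g ->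
    exists! c : {ffun 'I_n -> int}, g = translation (\sum_i e i *~ c i).

(* A holonomy element acts by conjugation by any of its representatives. *)
Definition diagonal_holonomy Gamma :=
  exists2 e : 'I_n -> 'cV[R]_n, lattice_basis Gamma e &
    forall g i, g \in Gamma ->
      (g * translation (e i) * g^-1)%g = translation (e i) \/
      (g * translation (e i) * g^-1)%g = translation (- e i).

Definition orientation_preserving Gamma :=
  forall g, g \in Gamma -> \det (linear_part g) = 1.

End Crystallographic.

Definition diagonal_type (R : realType) (n : nat)
    (Gamma : groupClosed (eisom R n)) :=
  crystallographic Gamma /\
  exists (m : nat) (Delta : groupClosed (eisom R m)),
    [/\ crystallographic Delta, diagonal_holonomy Delta &
        isomorphic (subgroup_type Gamma) (subgroup_type Delta)].

(* C_2^k is the additive group of 'rV['F_2]_k. *)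
Definition hantzsche_wendt (R : realType) (n : nat)
    (Gamma : groupClosed (eisom R n)) :=
  [/\ (0 < n)%N, bieberbach Gamma, orientation_preserving Gamma &
      holonomy_isog Gamma 'rV['F_2]_(n.-1)].

(* Main.v *)
(* By Gardam, the group ring over F_2 of the Promislow group
   <a, b | b a^2 b^-1 = a^-2, a b^2 a^-1 = b^-2> has a nontrivial unit. In a
   torsion-free group two nontrivial elements with these relations generate a
   copy of it. A holonomy group C_2^(n-1) in SO(n) consists of all diagonal sign
   matrices of determinant 1 in a suitable basis; so n is odd, since -1 would be
   the linear part of a torsion element, and for n >= 3 any two isometries whose
   linear parts fix just one coordinate each, a different one, satisfy the
   relations. If the holonomy group is C_2^2, let K consist of the elements
   without translation along the subspace fixed by the holonomy. If K has full
   holonomy it contains such a pair; otherwise two further translation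
   homomorphisms to Z^k reduce K to the trivial group, and G is poly-Z.
   Conversely, a poly-Z group is left-orderable, so its group rings over fields
   have only trivial units. *)
Require Import Defs.
From HB Require Import structures.
From mathcomp Require Import all_boot all_order all_algebra.
From mathcomp Require Import finmap zify lra.
From mathcomp Require Import all_classical all_reals all_analysis.

Set Implicit Arguments.
Unset Strict Implicit.
Unset Printing Implicit Defensive.

Import Order.TTheory GRing.Theory Num.Theory.
Import numFieldNormedType.Exports.

Local Open Scope classical_set_scope.
Local Open Scope ring_scope.

(** * Integer powers in a group *)

Section IntegerPowers.
Local Open Scope group_scope.
Variable G : groupType.
Implicit Types (g x : G) (i j : int).

Definition expgz x i : G :=
  match i with Posz n => x ^+ n | Negz n => x ^- n.+1 end.

Lemma expgzS x i : expgz x (i + 1)%R = expgz x i * x.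
Proof.
case: i => [n|[|n]].
- have -> : (n%:Z + 1)%R = n.+1 by lia.
  exact: expgSr.
- by rewrite /= mulVg.
have -> : (Negz n.+1 + 1)%R = Negz n by lia.
by rewrite /= [in RHS]expgS invgM mulgVK.
Qed.

Lemma expgzD x i j : expgz x (i + j)%R = expgz x i * expgz x j.
Proof.
elim/int_ind: j => [|n IH|n IH]; first by rewrite addr0 mulg1.
  have -> : n.+1%:Z = (n%:Z + 1)%R by lia.
  by rewrite addrA !expgzS IH mulgA.
apply: (mulIg x); rewrite -expgzS -mulgA -expgzS -addrA.
by have -> : (- n.+1%:Z + 1 = - n%:Z)%R by lia.
Qed.

Lemma expgzN x i : expgz x (- i)%R = (expgz x i)^-1.
Proof. by apply: (mulIg (expgz x i)); rewrite -expgzD addNr mulVg. Qed.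

Lemma expgz_fix g x i : g * x = x * g -> g * expgz x i = expgz x i * g.
Proof.
move=> gx; case: i => n /=; first exact: commuteX.
exact/commuteV/commuteX.
Qed.

Lemma expgz_flip g x i :
  g * x = x^-1 * g -> g * expgz x i = expgz x (- i)%R * g.
Proof.
move=> gx; have pos n : g * x ^+ n = x ^- n * g.
  elim: n => [|n IH]; first by rewrite invg1 mulg1 mul1g.
  by rewrite expgSr mulgA IH -mulgA gx mulgA -invgM -expgS expgSr.
rewrite expgzN; case: i => n /=; first exact: pos.
by rewrite invgK; apply: (mulIg (x ^+ n.+1)); rewrite mulgVK -mulgA pos mulVKg.
Qed.

Lemma expgz_commute x y i j : x * y = y * x ->
  expgz x i * expgz y j = expgz y j * expgz x i.
Proof. by move=> xy; apply/expgz_fix/esym/expgz_fix. Qed.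

Lemma expgz_eq1 x i : torsion_free G -> x != 1 -> expgz x i = 1 -> i = 0.
Proof.
move=> tfG /eqP x1; case: i => [[|n]|n] //= xn; case: x1.
  exact: (tfG x n.+1).
by apply: (tfG x n.+1) => //; apply: invg_inj; rewrite xn invg1.
Qed.

End IntegerPowers.

(** * Normal forms in the Promislow group *)

Section PromislowPair.
Local Open Scope group_scope.
Variables (G : groupType) (a b : G).
Local Notation x := (a * a).
Local Notation y := (b * b).
Local Notation z := (a * b * (a * b)).

(* The defining relations of the Promislow (three-dimensional Hantzsche-Wendt)
   group. *)
Hypotheses (bx : b * x = x^-1 * b) (ay : a * y = y^-1 * a).

Lemma promislow_ax : a * x = x * a. Proof. by rewrite mulgA. Qed.
Lemma promislow_by : b * y = y * b. Proof. by rewrite mulgA. Qed.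

Lemma promislow_ya : y * a = a * y^-1.
Proof. by apply: (mulIg y); rewrite mulgVK -mulgA ay mulVKg. Qed.

(** Equivalent to z a z = a: in z a z the factor a a after the second b is inverted by [bx], then b
    b is moved past a, and everything cancels down to a. *)
Lemma promislow_az : a * z = z^-1 * a.
Proof.
apply: (mulgI z); rewrite mulVKg.
have -> : z * (a * z) = a * b * a * (b * x) * b * a * b by rewrite !mulgA.
rewrite bx.
have -> : a * b * a * (x^-1 * b) * b * a * b = a * b * a * x^-1 * (y * a) * b.
  by rewrite !mulgA.
rewrite promislow_ya.
have -> : a * b * a * x^-1 * (a * y^-1) * b = a * b * (a * x^-1 * a) * y^-1 * b.
  by rewrite !mulgA.
by rewrite invgM mulVKg mulVg mulg1 invgM mulgA mulgK mulgVK.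
Qed.

(** This brings b a into normal form. Since z^-1 (a b) = (a b)^-1, the right side is x^-1 y b^-1
    a^-1 = x^-1 b a^-1, and [bx] turns x^-1 b into b x. *)
Lemma promislow_ba : b * a = x^-1 * y * z^-1 * (a * b).
Proof.
have -> : x^-1 * y * z^-1 * (a * b) = x^-1 * b * a^-1.
  by rewrite -[LHS]mulgA [z^-1]invgM mulgVK [(a * b)^-1]invgM !mulgA mulgK.
by rewrite -bx mulgA mulgK.
Qed.

(** Conjugation by a fixes x and conjugation by b inverts it, so a b inverts x and its square
    commutes with x. *)
Lemma promislow_xz : x * z = z * x.
Proof.
have e : a * b * x = x^-1 * (a * b).
  by rewrite -mulgA bx !mulgA; congr (_ * _); rewrite invgM mulVKg mulgVK.
apply/esym; rewrite -(mulgA (a * b)) e mulgA.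
have -> : a * b * x^-1 = x * (a * b).
  by apply: (mulIg x); rewrite mulgVK -mulgA e mulVKg.
by rewrite !mulgA.
Qed.

Lemma promislow_xy : x * y = y * x.
Proof.
by rewrite -mulgA ay mulgA -promislow_ya -mulgA.
Qed.

Lemma promislow_bz : b * z = z^-1 * b.
Proof.
have za : a * z^-1 = z * a by apply: (mulIg z); rewrite mulgVK -mulgA promislow_az mulVKg.
by apply: (mulgI a); rewrite [RHS]mulgA za !mulgA.
Qed.

Lemma promislow_yz : y * z = z * y.
Proof.
have e : a * b * y = y^-1 * (a * b) by rewrite -mulgA promislow_by mulgA ay mulgA.
apply/esym; rewrite -(mulgA (a * b)) e mulgA.
have -> : a * b * y^-1 = y * (a * b).
  by apply: (mulIg y); rewrite mulgVK -mulgA e mulVKg.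
by rewrite -mulgA.
Qed.

(** The tuple (i, j, k, s, t) encodes the normal form x^i y^j z^k a^s b^t, so that products can be
    evaluated by computation. *)
Definition promislow_elt := (int * int * int * bool * bool)%type.
Implicit Types (s t : bool) (i j k : int) (p q : promislow_elt).

Definition flip s i : int := if s then (- i)%R else i.

(* ([a^s b^t][a^s' b^t']) = x^u y^v z^w a^(s + s') b^(t + t') *)
Definition promislow_cocycle s t s' t' : int * int * int :=
  match s, t, s', t' with
  | true, false, true, _ => (1, 0, 0)
  | false, true, true, false => (-1, 1, -1)
  | false, true, false, true => (0, 1, 0)
  | false, true, true, true => (-1, 0, -1)
  | true, true, true, false => (0, -1, 1)
  | true, true, false, true => (0, -1, 0)
  | true, true, true, true => (0, 0, 1)
  | _, _, _, _ => (0, 0, 0)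
  end%R.

(** Moving x^i' y^j' z^k' to the left past a^s b^t negates exponents: b inverts x, a inverts y, and
    each of them inverts z. The cocycle accounts for the product of the remaining factors. *)
Definition promislow_mul p q : promislow_elt :=
  let: (i, j, k, s, t) := p in
  let: (i', j', k', s', t') := q in
  let: (u, v, w) := promislow_cocycle s t s' t' in
  (i + flip t i' + u, j + flip s j' + v, k + flip (s (+) t) k' + w,
    s (+) s', t (+) t')%R.

Definition promislow_translation i j k := expgz x i * expgz y j * expgz z k.
Local Notation T := promislow_translation.

Definition promislow_rep s t : G := (if s then a else 1) * (if t then b else 1).

Definition promislow_eval p : G :=
  let: (i, j, k, s, t) := p in T i j k * promislow_rep s t.

Lemma promislow_translationD i j k i' j' k' :
  T i j k * T i' j' k' = T (i + i')%R (j + j')%R (k + k')%R.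
Proof.
have yx := expgz_commute j i' (esym promislow_xy).
have zx := expgz_commute k i' (esym promislow_xz).
have zy := expgz_commute k j' (esym promislow_yz).
rewrite /T !expgzD; move: (expgz x i) (expgz x i') (expgz y j) (expgz y j')
  (expgz z k) (expgz z k') yx zx zy => X X' Y Y' Z Z' yx zx zy.
rewrite -!mulgA; congr (_ * _).
by rewrite (mulgA Z) zx -(mulgA X') (mulgA Z) zy -(mulgA Y') (mulgA Y) yx -(mulgA X').
Qed.

Lemma promislow_repT s t i j k : promislow_rep s t * T i j k =
  T (flip t i) (flip s j) (flip (s (+) t) k) * promislow_rep s t.
Proof.
have conjT (g : G) l m n l' m' n' :
    g * expgz x l = expgz x l' * g -> g * expgz y m = expgz y m' * g ->
    g * expgz z n = expgz z n' * g -> g * T l m n = T l' m' n' * g.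
  rewrite /T; move: (expgz x l) (expgz x l') (expgz y m) (expgz y m') (expgz z n)
    (expgz z n') => X X' Y Y' Z Z' ex ey ez.
  by rewrite !mulgA ex -(mulgA _ g) ey !mulgA -(mulgA _ g) ez !mulgA.
have aT l m n : a * T l m n = T l (- m)%R (- n)%R * a.
  apply: conjT; [exact/expgz_fix/promislow_ax | exact: expgz_flip |].
  exact/expgz_flip/promislow_az.
have bT l m n : b * T l m n = T (- l)%R m (- n)%R * b.
  apply: conjT; [exact: expgz_flip | exact/expgz_fix/promislow_by |].
  exact/expgz_flip/promislow_bz.
rewrite /promislow_rep; case: s t => [] [] /=; rewrite ?mulg1 ?mul1g //.
by rewrite -mulgA bT mulgA aT opprK mulgA.
Qed.

Lemma promislow_repM s t s' t' :
  let: (u, v, w) := promislow_cocycle s t s' t' in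
  promislow_rep s t * promislow_rep s' t' =
    T u v w * promislow_rep (s (+) s') (t (+) t').
Proof.
have T1 : T 0 0 0 = 1 by rewrite /T !mulg1.
have Tx : T 1 0 0 = x by rewrite /T !mulg1.
have Ty : T 0 1 0 = y by rewrite /T mulg1 mul1g.
have Tz : T 0 0 1 = z by rewrite /T !mul1g.
have ba : b * a = T (- 1)%R 1 (- 1)%R * (a * b) by exact: promislow_ba.
have aT l m n : a * T l m n = T l (- m)%R (- n)%R * a.
  by have := promislow_repT true false l m n; rewrite /promislow_rep /= mulg1.
rewrite /promislow_cocycle /promislow_rep.
(* Four of the sixteen products remain: a b times a, a b times b, a times a b, and b times a b. *)
case: s t s' t' => [] [] [] [] /=; rewrite ?mulg1 ?mul1g ?T1 ?Tx ?mul1g //.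
- have -> : T 0 (- 1)%R 1 = T (- 1)%R (- 1)%R 1 * x.
    by rewrite -Tx promislow_translationD.
  by rewrite -mulgA ba mulgA aT -!mulgA.
- by rewrite -mulgA -Ty aT oppr0.
- by rewrite mulgA.
- have -> : T (- 1)%R 0 (- 1)%R = T (- 1)%R 1 (- 1)%R * T 0 (- 1)%R 0.
    by rewrite promislow_translationD.
  have e : a * b * b = T 0 (- 1)%R 0 * a by rewrite -mulgA -Ty aT oppr0.
  by rewrite mulgA ba -[LHS]mulgA e [LHS]mulgA.
Qed.

Lemma promislow_evalM p q :
  promislow_eval (promislow_mul p q) = promislow_eval p * promislow_eval q.
Proof.
case: p q => [[[[i j] k] s] t] [[[[i' j'] k'] s'] t'] /=.
have := promislow_repM s t s' t'.
case: promislow_cocycle => [[u v] w] /= e.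
rewrite -[RHS]mulgA (mulgA (promislow_rep s t)) promislow_repT.
by rewrite -(mulgA _ (promislow_rep s t)) e 2![RHS]mulgA !promislow_translationD.
Qed.

Hypotheses (tfG : torsion_free G) (a1 : a != 1) (b1 : b != 1).

Lemma torsion_free_sqr (g : G) : g != 1 -> g * g != 1.
Proof. by move=> g1; apply: contra_neq g1 => /(tfG (x := g) (k := 2) isT). Qed.

(** If a b = 1, then b = a^-1 both commutes with a^2 and inverts it, so a^4 = 1, against
    torsion-freeness. *)
Lemma promislow_ab : a * b != 1.
Proof.
apply/eqP => ab1; have eb : b = a^-1 by apply: (mulgI a); rewrite ab1 mulgV.
have xV : x^-1 = x by apply: (mulIg b); rewrite -bx eb mulKg mulgK.
have /eqP := torsion_free_sqr (torsion_free_sqr a1).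
by rewrite -{1}xV mulVg.
Qed.

(** Conjugation by a negates j and k; multiplying the conjugate by the original leaves x^(2i) = 1,
    hence i = 0. Conjugation by b gives j = 0 likewise, and then z^k = 1. *)
Lemma promislow_translation_eq1 i j k : T i j k = 1 -> [/\ i = 0, j = 0 & k = 0]%R.
Proof.
move=> T1.
have double_eq0 (l : int) (g : G) : g != 1 -> expgz g (l + l)%R = 1 -> l = 0%R.
  by move=> g1 /(expgz_eq1 tfG g1); lia.
have aT : T i (- j)%R (- k)%R = 1.
  apply: (mulIg (promislow_rep true false)).
  by rewrite -(promislow_repT true false i j k) T1 mul1g mulg1.
have bT : T (- i)%R j (- k)%R = 1.
  apply: (mulIg (promislow_rep false true)).
  by rewrite -(promislow_repT false true i j k) T1 mul1g mulg1.
have i0 : i = 0%R.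
  apply: (double_eq0 _ x); first exact: torsion_free_sqr.
  have := promislow_translationD i j k i (- j)%R (- k)%R.
  by rewrite T1 aT !subrr /T !mulg1.
have j0 : j = 0%R.
  apply: (double_eq0 _ y); first exact: torsion_free_sqr.
  have := promislow_translationD i j k (- i)%R j (- k)%R.
  by rewrite T1 bT !subrr /T !mulg1 mul1g.
split=> //; move: T1; rewrite i0 j0 /T !mul1g.
by apply: expgz_eq1 => //; apply/torsion_free_sqr/promislow_ab.
Qed.

(** The signs with which an element acts on x and y by conjugation determine t and s. Two normal
    forms with the same s and t differ by a trivial translation. *)
Lemma promislow_eval_inj : injective promislow_eval.
Proof.
have flip_inj s s' (g : G) : g != 1 ->
    expgz g (flip s 1) = expgz g (flip s' 1) -> s = s'.
  move=> g1 e; have : expgz g (flip s 1 - flip s' 1)%R = 1.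
    by rewrite expgzD expgzN e mulgV.
  by move/(expgz_eq1 tfG g1); case: s s' {e} => [] [].
have TT i j k i' j' k' : T i j k * T i' j' k' = T i' j' k' * T i j k.
  by rewrite !promislow_translationD; congr T; rewrite addrC.
case=> [[[[i j] k] s] t] [[[[i' j'] k'] s'] t'] e.
have conj l m n : promislow_eval (i, j, k, s, t) * T l m n =
    T (flip t l) (flip s m) (flip (s (+) t) n) * promislow_eval (i, j, k, s, t).
  by rewrite /= -mulgA promislow_repT mulgA TT -mulgA.
have conj' l m n : promislow_eval (i', j', k', s', t') * T l m n =
    T (flip t' l) (flip s' m) (flip (s' (+) t') n) * promislow_eval (i', j', k', s', t').
  by rewrite /= -mulgA promislow_repT mulgA TT -mulgA.
have flip0 r : flip r 0 = 0%R by case: r.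
have et : t = t'.
  apply: (flip_inj _ _ x); first exact: torsion_free_sqr.
  have := conj 1%R 0%R 0%R; rewrite e conj' => /mulIg.
  by rewrite !flip0 /T !mulg1 => ->.
have es : s = s'.
  apply: (flip_inj _ _ y); first exact: torsion_free_sqr.
  have := conj 0%R 1%R 0%R; rewrite e conj' => /mulIg.
  by rewrite !flip0 /T !mulg1 !mul1g => ->.
move: e; rewrite /= et es => /mulIg eT.
have : T (i - i')%R (j - j')%R (k - k')%R = 1.
  by rewrite -promislow_translationD eT promislow_translationD !subrr /T !mulg1.
move=> /promislow_translation_eq1[/subr0_eq-> /subr0_eq-> /subr0_eq->].
by [].
Qed.

End PromislowPair.

(** * Group rings over F_2 and Gardam's unit *)

Section GroupRingFacts.
Variables (K : nzRingType) (G : groupType).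
Implicit Types (f g : group_ring K G) (x y : G).

Definition coef x f : K := (f : {fsfun G -> K with 0}) x.

Lemma coef_sum x (I : Type) (r : seq I) (P : pred I) (F : I -> group_ring K G) :
  coef x (\sum_(i <- r | P i) F i) = \sum_(i <- r | P i) coef x (F i).
Proof. by apply: big_morph => [f g|]; [exact: gr_addE | exact: gr_zeroE]. Qed.

Lemma gr_monomialM (c d : K) x y :
  gr_monomial c x * gr_monomial d y = gr_monomial (c * d) (x * y)%g :> group_ring K G.
Proof.
apply/fsfunP => w.
rewrite [LHS](@gr_mulEw _ _ [fset x]%fset); last exact: finsupp_sub.
rewrite big_seq_fset1 !gr_monomialE eqxx.
have -> : (x^-1 * w == y)%g = (w == x * y)%g.
  by apply/eqP/eqP => [<-|->]; rewrite ?mulVKg ?mulKg.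
by case: ifP => //; rewrite mulr0.
Qed.

End GroupRingFacts.

(** Reduces a formal sum modulo 2: an entry that is already present cancels against its earlier
    copy. *)
Definition cancel_pairs (T : eqType) (s : seq T) : seq T :=
  foldr (fun x r => if x \in r then rem x r else x :: r) [::] s.

Lemma sum_cancel_pairs (T : eqType) (V : zmodType) (F : T -> V) (s : seq T) :
  (forall x, F x + F x = 0) ->
  \sum_(x <- s) F x = \sum_(x <- cancel_pairs s) F x.
Proof.
move=> F2; elim: s => //= x s IH; rewrite big_cons IH.
case: ifP => [xr|_]; last by rewrite big_cons.
by rewrite [in LHS](perm_big _ (perm_to_rem xr)) big_cons addrA F2 add0r.
Qed.

(* With x = a^2, y = b^2, z = (a b)^2: Gardam's unit p + q a + r b + s a b, where
   p = (1 + x) (1 + y) (1 + z^-1),            q = x^-1 y^-1 + x + y^-1 z + z,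
   r = 1 + x + y^-1 z + x y z,                s = 1 + (x + x^-1 + y + y^-1) z^-1,
   and its inverse
   x^-1 a^-1 p a + x^-1 q a + y^-1 r b + z^-1 (a^-1 s a) a b. *)
Definition gardam_unit : seq promislow_elt :=
  [:: (0, 0, 0, false, false); (0, 0, -1, false, false);
      (0, 1, 0, false, false); (0, 1, -1, false, false);
      (1, 0, 0, false, false); (1, 0, -1, false, false);
      (1, 1, 0, false, false); (1, 1, -1, false, false);
      (-1, -1, 0, true, false); (1, 0, 0, true, false);
      (0, -1, 1, true, false); (0, 0, 1, true, false);
      (0, 0, 0, false, true); (1, 0, 0, false, true);
      (0, -1, 1, false, true); (1, 1, 1, false, true);
      (0, 0, 0, true, true); (1, 0, -1, true, true);
      (-1, 0, -1, true, true); (0, 1, -1, true, true);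
      (0, -1, -1, true, true)]%Z.

Definition gardam_inverse : seq promislow_elt :=
  [:: (-1, 0, 0, false, false); (-1, 0, 1, false, false);
      (-1, -1, 0, false, false); (-1, -1, 1, false, false);
      (0, 0, 0, false, false); (0, 0, 1, false, false);
      (0, -1, 0, false, false); (0, -1, 1, false, false);
      (-2, -1, 0, true, false); (0, 0, 0, true, false);
      (-1, -1, 1, true, false); (-1, 0, 1, true, false);
      (0, -1, 0, false, true); (1, -1, 0, false, true);
      (0, -2, 1, false, true); (1, 0, 1, false, true);
      (0, 0, -1, true, true); (1, 0, 0, true, true);
      (-1, 0, 0, true, true); (0, -1, 0, true, true);
      (0, 1, 0, true, true)]%Z.

(** All of the 21 * 21 products except one copy of the identity cancel in pairs. *)
Lemma gardam_unitK : cancel_pairs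
  [seq promislow_mul p q | p <- gardam_unit, q <- gardam_inverse] =
  [:: (0, 0, 0, false, false)].
Proof. by vm_compute. Qed.

Lemma gardam_inverseK : cancel_pairs
  [seq promislow_mul p q | p <- gardam_inverse, q <- gardam_unit] =
  [:: (0, 0, 0, false, false)].
Proof. by vm_compute. Qed.

Theorem promislow_pair_not_unit_conjecture (G : groupType) (a b : G) :
  torsion_free G -> a != 1%g -> b != 1%g ->
  (b * (a * a) = (a * a)^-1 * b)%g -> (a * (b * b) = (b * b)^-1 * a)%g ->
  ~ unit_conjecture 'F_2 G.
Proof.
move=> tfG a1 b1 bx ay UC.
pose ev := promislow_eval a b.
have ev_inj : injective ev by exact: promislow_eval_inj.
pose mono p : group_ring 'F_2 G := gr_monomial 1 (ev p).
have mono2 p : mono p + mono p = 0.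
  apply/fsfunP => w; rewrite [LHS]gr_addE gr_monomialE [RHS]gr_zeroE.
  by case: ifP => _; rewrite ?addr0 //; apply/val_inj.
have monoM p q : mono p * mono q = mono (promislow_mul p q).
  by rewrite gr_monomialM mulr1 /mono /ev promislow_evalM.
have inverse (s s' : seq promislow_elt) :
    cancel_pairs [seq promislow_mul p q | p <- s, q <- s'] =
      [:: (0, 0, 0, false, false)] ->
    (\sum_(p <- s) mono p) * (\sum_(q <- s') mono q) = 1.
  move=> e; rewrite big_distrlr /=.
  under eq_bigr do under eq_bigr do rewrite monoM.
  (* The double sum becomes one sum over the list of products, where equal terms cancel because the
     coefficients have characteristic 2. *)
  rewrite -(@big_allpairs_dep _ _ _ _ _ _
    (fun p q => promislow_mul p q) s (fun=> s') mono).
  rewrite (sum_cancel_pairs _ mono2) e.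
  by rewrite big_seq1 /mono /ev /= /promislow_translation /promislow_rep !mulg1.
have [|c [g [_ ug]]] := UC (\sum_(p <- gardam_unit) mono p).
  exists (\sum_(q <- gardam_inverse) mono q).
  by split; apply: inverse; [exact: gardam_unitK | exact: gardam_inverseK].
(* The list has no repetitions and [ev] is injective, so every entry has coefficient 1. In a trivial
   unit all entries would then evaluate to the same [g], which the entries for 1 and x
   contradict. *)
have evg p : p \in gardam_unit -> ev p = g.
  move=> pu; have : coef (ev p) (\sum_(q <- gardam_unit) mono q) = 1.
    rewrite coef_sum (perm_big _ (perm_to_rem pu)) big_cons.
    rewrite {1}/coef gr_monomialE eqxx big_seq big1 => [|q]; first exact: addr0.
    rewrite mem_rem_uniq // !inE => /andP[qp _].
    by rewrite /coef gr_monomialE; case: eqP => // /ev_inj pq; rewrite pq eqxx in qp.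
  by rewrite ug /coef gr_monomialE; case: eqP => // _ /eqP.
have /ev_inj // : ev (0, 0, 0, false, false) = ev (1, 0, 0, false, false).
by rewrite !evg.
Qed.


(** * Subgroups, homomorphisms and quotients *)

(** Subgroups as plain sets: kernels and intersections are then formed directly, and
    [to_groupClosed] converts back where a series is required. *)
Definition is_subgroup (G : groupType) (H : set G) :=
  H 1%g /\ forall x y, H x -> H y -> H (x * y^-1)%g.

Section Subgroups.
Variables (G : groupType) (H : set G).
Hypothesis sH : is_subgroup H.

Lemma is_subgroupV x : H x -> H x^-1%g.
Proof. by move=> Hx; rewrite -[(x^-1)%g]mul1g; apply: sH.2 => //; apply: sH.1. Qed.

Lemma is_subgroupM x y : H x -> H y -> H (x * y)%g.
Proof. by move=> Hx Hy; rewrite -[y]invgK; apply: sH.2 => //; exact: is_subgroupV. Qed.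

Lemma is_subgroup_expgz x i : H x -> H (expgz x i).
Proof.
move=> Hx; have pos n : H (x ^+ n)%g.
  elim: n => [|n IH]; first exact: sH.1.
  by rewrite expgS; exact: is_subgroupM.
by case: i => n /=; [exact: pos | apply/is_subgroupV/pos].
Qed.

Definition subgroup_pred of is_subgroup H : {pred G} := fun x => `[< H x >].

Fact subgroup_pred1 : 1%g \in subgroup_pred sH.
Proof. by apply/asboolP; exact: sH.1. Qed.
Fact subgroup_predM : mulg_closed (subgroup_pred sH).
Proof. by move=> x y /asboolP Hx /asboolP Hy; apply/asboolP/is_subgroupM. Qed.
Fact subgroup_predV : invg_closed (subgroup_pred sH).
Proof. by move=> x /asboolP Hx; apply/asboolP/is_subgroupV. Qed.

HB.instance Definition _ := isMulClosed.Build G (subgroup_pred sH) subgroup_predM.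
HB.instance Definition _ := isMul1Closed.Build G (subgroup_pred sH) subgroup_pred1.
HB.instance Definition _ := isInvClosed.Build G (subgroup_pred sH) subgroup_predV.

Definition to_groupClosed : groupClosed G := subgroup_pred sH.

Lemma in_groupClosed x : (x \in to_groupClosed) = `[< H x >].
Proof. by []. Qed.

End Subgroups.

Lemma groupClosed_is_subgroup (G : groupType) (S : groupClosed G) :
  is_subgroup [set` S].
Proof. by split => [|x y]; [exact: gpred1 | exact: gpredF]. Qed.

Definition hom_on (G : groupType) (V : zmodType) (H : set G) (f : G -> V) :=
  forall x y, H x -> H y -> f (x * y)%g = f x + f y.

Section Homomorphisms.
Variables (G : groupType) (V : zmodType) (H : set G) (f : G -> V).
Hypotheses (sH : is_subgroup H) (hf : hom_on H f).

Lemma hom_on1 : f 1%g = 0.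
Proof. by apply: (addrI (f 1%g)); rewrite -hf ?mulg1 ?addr0 //; exact: sH.1. Qed.

Lemma hom_onV x : H x -> f x^-1%g = - f x.
Proof.
move=> Hx; apply: (addrI (f x)).
by rewrite -hf ?mulgV ?hom_on1 ?subrr //; exact: is_subgroupV.
Qed.

Lemma hom_on_expgz x i : H x -> f (expgz x i) = f x *~ i.
Proof.
move=> Hx; elim/int_ind: i => [|n IH|n IH]; first exact: hom_on1.
  have -> : n.+1%:Z = n%:Z + 1 by lia.
  by rewrite expgzS hf ?IH ?mulrzDr ?mulr1z //; exact: is_subgroup_expgz.
have -> : - n.+1%:Z = - n%:Z + - 1 by lia.
rewrite expgzD hf ?IH ?mulrzDr //; try exact: is_subgroup_expgz.
by rewrite expgzN hom_onV //= mulrNz mulr1z.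
Qed.

Lemma hom_on_ker_subgroup : is_subgroup (H `&` [set x | f x = 0]).
Proof.
split=> [|x y [Hx /= fx] [Hy /= fy]]; first by split; [exact: sH.1 | exact: hom_on1].
split; first exact: sH.2.
by rewrite /= hf ?hom_onV ?fx ?fy ?subrr //; exact: is_subgroupV.
Qed.

End Homomorphisms.

Lemma hom_onS (G : groupType) (V : zmodType) (H K : set G) (f : G -> V) :
  K `<=` H -> hom_on H f -> hom_on K f.
Proof. by move=> KH hf x y /KH Hx /KH Hy; exact: hf. Qed.

Section Quotients.
Variables (G : groupType) (A N : set G).
Hypotheses (sA : is_subgroup A) (sN : is_subgroup N) (NA : N `<=` A).

Lemma eq_left_coset x y : N (x^-1 * y)%g -> left_coset x N = left_coset y N.
Proof.
move=> Nxy; apply/seteqP; split=> _ [u Nu <-].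
  exists (y^-1 * x * u)%g; last by rewrite -mulgA mulVKg.
  apply: is_subgroupM => //; have := is_subgroupV sN Nxy.
  by rewrite invgM invgK.
exists (x^-1 * y * u)%g; last by rewrite -mulgA mulVKg.
exact: is_subgroupM.
Qed.

Lemma left_coset_eq x y : left_coset x N = left_coset y N -> N (x^-1 * y)%g.
Proof.
move=> e; have [u Nu <-] : left_coset x N y.
  by rewrite e; exists 1%g; rewrite ?mulg1 //; exact: sN.1.
by rewrite mulKg.
Qed.

Lemma prod_left_coset x y : (forall u, N u -> N (u ^ y)%g) ->
  prod_set (left_coset x N) (left_coset y N) = left_coset (x * y) N.
Proof.
move=> nNy; apply/seteqP; split=> [_ [_ [u Nu <-] [_ [v Nv <-] <-]]|_ [u Nu <-]].
  exists (u ^ y * v)%g; first by apply: is_subgroupM => //; exact: nNy.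
  by rewrite conjgE !mulgA mulgK.
exists x; first by exists 1%g; rewrite ?mulg1 //; exact: sN.1.
by exists (y * u)%g; [exists u | rewrite mulgA].
Qed.

(** The homomorphism is [phi] composed with x |-> x N; normality makes the product of two cosets the
    coset of the product. *)
Lemma quotient_isog_hom (V : zmodType) :
  (forall x u, A x -> N u -> N (u ^ x)%g) -> quotient_isog A N V ->
  exists h : G -> V, [/\ hom_on A h, forall x, A x -> h x = 0 <-> N x &
    forall v, exists2 x, A x & h x = v].
Proof.
move=> nN [phi [[_ phi_inj phi_surj] phiM]].
have cosetP x : A x -> left_cosets A N (left_coset x N) by exists x.
pose h x := phi (left_coset x N); have hh : hom_on A h.
  move=> x y Ax Ay; rewrite /h -prod_left_coset; last by move=> u; exact: nN.
  by apply: phiM; apply/mem_set/cosetP.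
exists h; split=> // [x Ax|v]; last first.
  by have [_ [x Ax <-] <-] := phi_surj v I; exists x.
split=> [hx|Nx].
  rewrite -[x]mul1g -invg1; apply/left_coset_eq/phi_inj.
  - by apply/mem_set/cosetP; exact: sA.1.
  - exact/mem_set/cosetP.
  by rewrite -/(h 1%g) -/(h x) (hom_on1 sA hh).
rewrite -(hom_on1 sA hh) /h; congr phi; apply/esym/eq_left_coset.
by rewrite invg1 mul1g.
Qed.

(** The image of [f] is d Z, where d is its least positive value, so [f] divided by d induces the
    bijection onto the integers. *)
Lemma hom_quotient_isog (f : G -> int) : hom_on A f ->
  (forall x, A x -> f x = 0 <-> N x) -> (exists2 x, A x & f x != 0) ->
  quotient_isog A N int.
Proof.
move=> hf kf [x1 Ax1 fx1].
have expo : exists n, `[< (0 < n)%N /\ exists2 x, A x & f x = n%:Z >].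
  exists `|f x1|%N; apply/asboolP; split; first by lia.
  have [fpos|fneg] := leP 0 (f x1); first by exists x1 => //; lia.
  by exists x1^-1%g; [exact: is_subgroupV | rewrite (hom_onV sA hf) //; lia].
case: (ex_minnP expo) => d /asboolP[d0 [x0 Ax0 fx0]] dmin.
(* The remainder of f x modulo d is again a value of [f], at x times a power of [x0]; minimality of
   d forces it to be 0. *)
have dvd x : A x -> (d%:Z %| f x)%Z.
  move=> Ax; apply/dvdz_mod0P; set r := (f x %% d)%Z.
  have r_ge0 : 0 <= r by rewrite modz_ge0 //; lia.
  have r_lt : r < d by rewrite ltz_pmod //; lia.
  have [//|rN0] := eqVneq r 0.
  have := dmin `|r|%N; rewrite leqNgt => /(_ _)/negP; case; last by lia.
  apply/asboolP; split; first by lia.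
  exists (x * expgz x0 (- (f x %/ d)%Z))%g.
    by apply: is_subgroupM => //; exact: is_subgroup_expgz.
  rewrite hf //; last exact: is_subgroup_expgz.
  rewrite (hom_on_expgz sA hf) // fx0 mulrzz.
  by have := divz_eq (f x) d; rewrite -/r; lia.
(* [f] is constant on each coset and is read off at a chosen element; 1 is the default for the empty
   set. *)
pose phi (C : set G) := (f (xget 1%g C) %/ d)%Z.
have phiE (C : set G) (v : int) : C !=set0 -> (forall x, C x -> f x = v) ->
    phi C = (v %/ d)%Z.
  by move=> [y Cy] fC; rewrite /phi; case: xgetP => [x _ /fC->|/(_ y)].
have phi_coset x : A x -> phi (left_coset x N) = (f x %/ d)%Z.
  move=> Ax; apply: phiE; first by exists x; exists 1%g; rewrite ?mulg1 //; exact: sN.1.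
  move=> _ [u Nu <-]; have Au := NA Nu.
  by rewrite hf // (kf u Au).2 // addr0.
exists phi; split; last first.
  move=> C D /set_mem[x Ax <-] /set_mem[y Ay <-].
  rewrite !phi_coset // -divzDl ?dvd //; apply: phiE.
    exists (x * y)%g; exists x; first by exists 1%g; rewrite ?mulg1 //; exact: sN.1.
    by exists y => //; exists 1%g; rewrite ?mulg1 //; exact: sN.1.
  move=> _ [_ [u Nu <-] [_ [v Nv <-] <-]].
  have [Au Av] := (NA Nu, NA Nv).
  by rewrite !hf ?(kf u Au).2 ?(kf v Av).2 ?addr0 //; exact: is_subgroupM.
split=> [C _ //|C D /set_mem[x Ax <-] /set_mem[y Ay <-]|v _].
  rewrite !phi_coset // => e; apply: eq_left_coset.
  have AVx := is_subgroupV sA Ax.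
  apply/kf; first exact: is_subgroupM.
  rewrite hf // (hom_onV sA hf) //.
  by rewrite -(divzK (dvd _ Ax)) -(divzK (dvd _ Ay)) e addNr.
have Av : A (expgz x0 v) by exact: is_subgroup_expgz.
exists (left_coset (expgz x0 v) N); first by exists (expgz x0 v).
by rewrite phi_coset // (hom_on_expgz sA hf) // fx0 mulrzz mulKz; lia.
Qed.

End Quotients.

(** * Poly-Z groups and left orders *)

(** Poly-Z by successive kernels. [f] may vanish on [H] or miss values, so coordinate homomorphisms
    can be used as they are. *)
Inductive polyZ (G : groupType) : set G -> Prop :=
| polyZ_trivial : polyZ [set 1%g]
| polyZ_hom (H : set G) (f : G -> int) : is_subgroup H -> hom_on H f ->
    polyZ (H `&` [set x | f x = 0]) -> polyZ H.

(** For a homomorphism to Z^k with poly-Z kernel: its coordinates are split off one at a time. *)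
Lemma polyZ_homs (G : groupType) (H : set G) k (f : nat -> G -> int) :
  is_subgroup H -> (forall i, hom_on H (f i)) ->
  polyZ (H `&` [set x | forall i, (i < k)%N -> f i x = 0]) -> polyZ H.
Proof.
elim: k H => [|k IH] H sH hf.
  by rewrite (_ : H `&` _ = H) //; apply/seteqP; split=> x; [case|split].
move=> pH; apply: (polyZ_hom sH (hf k)); apply: IH.
- exact: hom_on_ker_subgroup.
- by move=> i; apply: hom_onS (hf i) => x [].
rewrite (_ : _ `&` _ = H `&` [set x | forall i, (i < k.+1)%N -> f i x = 0]) //.
apply/seteqP; split=> x.
  move=> [[Hx /= fk] fi]; split=> // i; rewrite ltnS leq_eqVlt => /predU1P[->//|].
  exact: fi.
by move=> [Hx fi]; split=> [|i ik]; [split=> //; exact: fi | exact/fi/ltnW].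
Qed.

Lemma polyZ_poly_Z (G : groupType) : polyZ [set: G] -> poly_Z G.
Proof.
suff main (H : set G) : polyZ H -> exists m (S : nat -> groupClosed G),
    [/\ forall x, (x \in S 0%N) = `[< H x >], S m =i pred1 1%g &
      forall i, (i < m)%N -> normal_in (S i.+1) (S i) /\
          quotient_isog [set` S i] [set` S i.+1] int].
  move=> /main[m [S [S0 Sm SS]]]; exists m, S; split=> // x.
  by rewrite S0; apply/asboolP.
elim=> {H} [|H f sH hf _ [m [S [S0 Sm SS]]]].
  have s1 : is_subgroup [set (1%g : G)].
    by split=> // x y -> ->; rewrite /= mulgV.
  exists 0%N, (fun=> to_groupClosed s1); split=> // x.
  by rewrite in_groupClosed; apply/asboolP/eqP.
(* If [f] vanishes on [H], its kernel is [H] and the series is kept; otherwise [H] is put in front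
   of it. *)
have [[x1 Hx1 fx1]|f0] := pselect (exists2 x, H x & f x != 0); last first.
  exists m, S; split=> // x; rewrite S0.
  congr asbool; apply/propext; split=> [[]//|Hx]; split=> //=.
  by apply/eqP/negP => /negP fx; apply: f0; exists x.
exists m.+1, (fun i => if i is j.+1 then S j else to_groupClosed sH).
split=> // -[_|i]; last exact: SS.
have S0E x : x \in S 0%N <-> H x /\ f x = 0 by rewrite S0; split=> /asboolP.
split.
  split=> [x /S0E[Hx _]|x y /asboolP Hx /S0E[Hy fy]]; first exact/asboolP.
  have HVx := is_subgroupV sH Hx; have Hyx := is_subgroupM sH Hy Hx.
  apply/S0E; split; first by apply: is_subgroupM.
  by rewrite conjgE !hf // (hom_onV sH hf) // fy add0r addNr.
apply: (@hom_quotient_isog _ _ _ _ _ _ f).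
- exact: groupClosed_is_subgroup.
- exact: groupClosed_is_subgroup.
- by move=> x /S0E[Hx _]; exact/asboolP.
- by move=> x y /asboolP Hx /asboolP Hy; exact: hf.
- by move=> x /asboolP Hx; split=> [fx|/S0E[]//]; apply/S0E.
- by exists x1 => //; exact/asboolP.
Qed.

Lemma poly_Z_polyZ (G : groupType) : poly_Z G -> polyZ [set: G].
Proof.
move=> [m [S [S0 Sm SS]]].
(* The induction climbs from the trivial end of the series. *)
suff main j : (j <= m)%N -> polyZ [set` S (m - j)%N].
  have := main m (leqnn m); rewrite subnn (_ : [set` S 0%N] = setT) //.
  by apply/seteqP; split=> x // _; rewrite /= S0.
elim: j => [_|j IH jm].
  rewrite subn0 (_ : [set` S m] = [set 1%g]); first exact: polyZ_trivial.
  by apply/seteqP; split=> x /=; rewrite Sm => /eqP.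
have e : (m - j = (m - j.+1).+1)%N by lia.
have [[sub nrm] q] := SS (m - j.+1)%N ltac:(lia).
have sS i := groupClosed_is_subgroup (S i).
have [h [hh kh _]] := quotient_isog_hom (sS _) (sS _) nrm q.
apply: (polyZ_hom (sS _) hh).
rewrite (_ : _ `&` _ = [set` S (m - j)%N]); first exact/IH/ltnW.
apply/seteqP; rewrite e; split=> x /=; first by case=> Sx /(kh _ Sx).
by move=> Sx; have Ax := sub _ Sx; split=> //; exact/kh.
Qed.

(* Positive cone of a left order: x < y means P (x^-1 * y). *)
Definition positive_cone (G : groupType) (P : set G) :=
  [/\ ~ P 1%g, forall x y, P x -> P y -> P (x * y)%g &
      forall x, x = 1%g \/ P x \/ P x^-1%g].

(** The order is lexicographic: an element is positive if its value under [f] is, or if it lies in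
    the cone already built on the kernel. *)
Lemma polyZ_positive_cone (G : groupType) :
  polyZ [set: G] -> exists P : set G, positive_cone P.
Proof.
suff main (H : set G) : polyZ H -> exists P : set G, [/\ P `<=` H, ~ P 1%g,
    forall x y, P x -> P y -> P (x * y)%g &
    forall x, H x -> x = 1%g \/ P x \/ P x^-1%g].
  move=> /main[P [_ P1 PM Pt]]; exists P; split=> // x; exact: Pt.
elim=> {H} [|H f sH hf _ [P [PH P1 PM Pt]]].
  by exists set0; split=> // x ->; left.
exists [set x | H x /\ (0 < f x \/ P x)]; split.
- by move=> x [].
- by move=> [_ []//]; rewrite (hom_on1 sH hf) ltxx.
- move=> x y [Hx px] [Hy py]; split; first exact: is_subgroupM.
  rewrite hf //; case: px py => [fx|Px] [fy|Py].
  + by left; exact: addr_gt0.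
  + by have [_ /= ->] := PH _ Py; rewrite addr0; left.
  + by have [_ /= ->] := PH _ Px; rewrite add0r; left.
  + by right; exact: PM.
move=> x Hx; have HVx := is_subgroupV sH Hx; have fV := hom_onV sH hf Hx.
have [fx|fx|fx] := ltgtP (f x) 0.
- by right; right; split=> //; left; rewrite fV oppr_gt0.
- by right; left; split=> //; left.
have [->|[Px|Px]] := Pt x (conj Hx fx); first by left.
  by right; left; split=> //; right.
by right; right; split=> //; right.
Qed.

Lemma positive_coneV (G : groupType) (P : set G) :
  positive_cone P -> positive_cone [set x | P x^-1%g].
Proof.
move=> [P1 PM Pt]; split=> /=; rewrite ?invg1 //.
  by move=> x y Px Py; rewrite invgM; exact: PM.
by move=> x; rewrite invgK; case: (Pt x) => [|[|]]; [left | right; right | right; left].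
Qed.

Lemma positive_cone_max (G : groupType) (P : set G) (s : seq G) x0 :
  positive_cone P -> x0 \in s ->
  exists2 m, m \in s & forall x, x \in s -> x = m \/ P (x^-1 * m)%g.
Proof.
move=> [P1 PM Pt]; elim: s x0 => // y [|z s] IH x0 _.
  by exists y; rewrite ?mem_head // => x; rewrite inE => /eqP; left.
have [m ms mmax] := IH z (mem_head _ _).
have [ym|[ym|my]] := Pt (y^-1 * m)%g.
- exists m => [|x]; first by rewrite inE ms orbT.
  rewrite inE => /predU1P[->|]; last exact: mmax.
  by left; rewrite -[m](mulVKg y) ym mulg1.
- exists m => [|x]; first by rewrite inE ms orbT.
  by rewrite inE => /predU1P[->|]; [right | exact: mmax].
exists y => [|x]; first exact: mem_head.
rewrite inE => /predU1P[->|/mmax]; first by left.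
move: my; rewrite invgM invgK => my [->|xm]; right=> //.
by have := PM _ _ xm my; rewrite mulgA mulgK.
Qed.

(** * Units over a left-ordered group *)

Section OrderedGroupRing.
Local Open Scope fset_scope.
Variables (K : fieldType) (G : groupType).
Implicit Types u v : group_ring K G.
Local Notation supp u := (finsupp (u : {fsfun G -> K with 0})).

(* The largest product of support elements is attained only once: for each
   left factor the right factor must be the largest one. *)
Lemma coef_max_product (P : set G) u v : positive_cone P -> u * v = 1 ->
  forall x y, x \in supp u -> y \in supp v -> (x * y)%g = 1%g \/ P (x * y)^-1%g.
Proof.
move=> cP uv x y xu yv; have [P1 PM Pt] := cP.
(* The order is only left-invariant, so once b is the largest element of the right support, a is
   chosen to maximize a b rather than a itself. *)
have [b bv bmax] := positive_cone_max cP yv.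
have [_ /mapP[a au ->] amax] :=
  positive_cone_max cP (map_f (fun x => x * b)%g xu).
have le_max x' y' : x' \in supp u -> y' \in supp v ->
    (x' = a /\ y' = b) \/ P ((x' * y')^-1 * (a * b))%g.
  move=> xu' yv'; have [ea|lt_a] := amax _ (map_f (fun x => x * b)%g xu').
    have {}ea : x' = a by exact: mulIg ea.
    have [eb|lt_b] := bmax _ yv'; first by left.
    by right; rewrite ea invgM -mulgA mulKg.
  right; have [->//|lt_b] := bmax _ yv'.
  have := PM _ _ lt_b lt_a; rewrite invgM !mulgA mulgK.
  by rewrite -!mulgA !invgM -!mulgA.
(* The coefficient of u v at a b is a single product of nonzero coefficients, and u v = 1 is
   supported at the identity. *)
have ab1 : (a * b = 1)%g.
  have := congr1 (coef (a * b)%g) uv.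
  rewrite {1}/coef [X in X = _]gr_mulE (big_fsetD1 a) //= mulKg big_seq big1.
    rewrite addr0 [RHS]gr_monomialE; case: eqP => // _ /eqP.
    by rewrite mulf_eq0 => /orP[]; rewrite -[_ == 0]negbK -mem_finsupp ?au ?bv.
  move=> z; rewrite in_fsetD1 => /andP[za zu].
  case: (finsuppP v) => [|bv']; first by rewrite mulr0.
  have [[ez]|] := le_max _ _ zu bv'; first by rewrite ez eqxx in za.
  by rewrite mulVKg mulVg.
have [[-> ->]|] := le_max _ _ xu yv; first by left.
by rewrite ab1 mulg1; right.
Qed.

(** The cone and its opposite bound every product of support elements by 1 from above and from
    below. So all these products equal 1, and the support of u is a single point. *)
Lemma positive_cone_unit_conjecture (P : set G) :
  positive_cone P -> unit_conjecture K G.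
Proof.
move=> cP u [v [uv _]].
have prod1 x y : x \in supp u -> y \in supp v -> (x * y = 1)%g.
  move=> xu yv; have [//|Pn] := coef_max_product cP uv xu yv.
  have [//|] := coef_max_product (positive_coneV cP) uv xu yv.
  rewrite /= invgK => Pp; have [P1 PM _] := cP.
  by case: P1; rewrite -(mulgV (x * y)%g); exact: PM.
have n0 (w : group_ring K G) : w != 0 -> exists x, x \in supp w.
  move=> w0; apply/fset0Pn; apply: contra_neq w0 => w0.
  apply/fsfunP => x; rewrite [RHS]gr_zeroE; apply/fsfun_dflt.
  by rewrite w0 inE.
have [|x xu] := n0 u.
  by apply/eqP => u0; move: uv (oner_neq0 (group_ring K G)); rewrite u0 mul0r => <-; rewrite eqxx.
have [|y yv] := n0 v.
  by apply/eqP => v0; move: uv (oner_neq0 (group_ring K G)); rewrite v0 mulr0 => <-; rewrite eqxx.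
exists (coef x u), x; split; first by rewrite -mem_finsupp.
apply/fsfunP => w; rewrite [RHS]gr_monomialE; case: eqP => [->//|wx].
apply/fsfun_dflt/negP => wu; case: wx; apply: (mulIg y).
by rewrite !prod1.
Qed.

End OrderedGroupRing.

Theorem poly_Z_unit_conjecture (K : fieldType) (G : groupType) :
  poly_Z G -> unit_conjecture K G.
Proof.
move=> /poly_Z_polyZ/polyZ_positive_cone[P cP].
exact: positive_cone_unit_conjecture cP.
Qed.

(** * Integer coordinates on discrete subgroups of R^n *)

Section DiscreteLattices.
Variables (R : realType) (n : nat) (T : set 'rV[R]_n) (eps : R).
Hypotheses (eps0 : 0 < eps) (T0 : T 0) (TB : forall u v, T u -> T v -> T (u - v)).
Hypothesis Tdiscr : forall v, T v -> (forall j, `|v 0 j| < eps) -> v = 0.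

Lemma latticeN v : T v -> T (- v).
Proof. by move=> Tv; rewrite -[- v]add0r; exact: TB. Qed.

Lemma latticeD u v : T u -> T v -> T (u + v).
Proof. by move=> Tu Tv; rewrite -[v]opprK; apply/TB/latticeN. Qed.

Lemma lattice_mulz v (i : int) : T v -> T (v *~ i).
Proof.
move=> Tv; have pos k : T (v *+ k).
  by elim: k => [//|k IH]; rewrite mulrSr; exact: latticeD.
by case: i => k; [exact: pos | exact/latticeN/pos].
Qed.

Lemma lattice_int_comb k (M : 'M[R]_(k, n)) (m : 'rV[int]_k) :
  (forall i, T (row i M)) -> T (map_mx intr m *m M).
Proof.
move=> TM; rewrite mulmx_sum_row.
elim/big_ind: _ => //; [exact: latticeD|move=> i _].
by rewrite mxE scaler_int; exact: lattice_mulz.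
Qed.

(** A linearly independent family in [T] of maximal size: a vector of [T] outside its span would
    extend it. *)
Lemma lattice_spanning_family : exists k (M : 'M[R]_(k, n)),
  [/\ row_free M, forall i, T (row i M) & forall v, T v -> (v <= M)%MS].
Proof.
pose P k := `[< exists M : 'M[R]_(k, n), row_free M /\ forall i, T (row i M) >].
have P0 : exists k, P k.
  exists 0%N; apply/asboolP; exists 0; split; last by case.
  by rewrite /row_free mxrank0.
have Pn k : P k -> (k <= n)%N.
  by move=> /asboolP[M [/eqP Mfree _]]; rewrite -Mfree rank_leq_col.
case: (ex_maxnP P0 Pn) => k /asboolP[M [Mfree TM]] kmax.
exists k, M; split=> // v Tv; apply: contraT => vM.
have : P (k + 1)%N.
  apply/asboolP; exists (col_mx M v); split.
    have MMv : (M <= col_mx M v)%MS by rewrite -addsmxE addsmxSl.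
    have rk : (\rank M < \rank (col_mx M v))%N.
      rewrite (ltn_leqif (mxrank_leqif_sup MMv)); apply: contra vM => Mv.
      by apply: submx_trans Mv; rewrite -addsmxE addsmxSr.
    rewrite /row_free eqn_leq rank_leq_row /=.
    by apply: leq_trans rk; rewrite (eqP Mfree) addn1.
  move=> i; case: (split_ordP i) => j ->.
    by rewrite rowKu.
  by rewrite rowKd row_id.
by move/kmax; rewrite addn1 ltnn.
Qed.

(** Dirichlet's pigeonhole argument: two multiples of x nearly agree modulo integer vectors, and
    discreteness turns this into equality. The bound on the multiples does not depend on x, whence a
    common denominator. *)
Lemma lattice_coordinates_rational k (M : 'M[R]_(k, n)) :
  row_free M -> (forall i, T (row i M)) ->
  exists2 N : nat, (0 < N)%N & forall x : 'rV[R]_k, T (x *m M) ->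
    forall i, x 0 i *+ N \is a Num.int.
Proof.
move=> Mfree TM.
pose C := \sum_i \sum_j `|M i j|.
have C0 : 0 <= C by apply: sumr_ge0 => i _; apply: sumr_ge0.
(* With C / L < eps, a vector of [T] whose coordinates are at most 1/L in absolute value must
   vanish. *)
pose L := (Num.bound (C / eps)).+1.
have L0 : 0 < L%:R :> R by rewrite ltr0n.
have CL : C / L%:R < eps.
  rewrite ltr_pdivrMr // mulrC -ltr_pdivrMr //.
  apply: lt_le_trans (archi_boundP _) _; first by rewrite divr_ge0 // ltW.
  by rewrite ler_nat.
have small (y : 'rV[R]_k) : T (y *m M) -> (forall i, `|y 0 i| <= L%:R^-1) -> y = 0.
  move=> Ty yL; suff yM0 : y *m M = 0.
    by apply/(row_free_inj Mfree); rewrite yM0 mul0mx.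
  apply: Tdiscr Ty _ => j; apply: le_lt_trans CL.
  rewrite mxE; apply: le_trans (ler_norm_sum _ _ _) _.
  rewrite /C mulr_suml; apply: ler_sum => i _.
  rewrite normrM mulrC; apply: ler_pM => //.
  by rewrite (bigD1 j) //= lerDl; exact: sumr_ge0.
exists ((L ^ k)`!)%N; first exact: fact_gt0.
move=> x Tx.
pose frac (t : R) := t - (Num.floor t)%:~R.
have frac_ge0 t : 0 <= frac t by rewrite subr_ge0 floor_le.
have frac_lt1 t : frac t < 1.
  by have := floorD1_gt t; rewrite /frac ltrBlDl intrD.
have cell_lt t : (`|Num.floor (frac t * L%:R)| < L)%N.
  have f0 : 0 <= Num.floor (frac t * L%:R) by rewrite floor_ge0 mulr_ge0 // ltW.
  rewrite -ltz_nat gez0_abs // floor_lt_int.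
  by rewrite -[X in _ < X]mul1r ltr_pM2r.
(* The unit cube is cut into L^k cells of side 1/L, and the multiples 0 x, ..., L^k x are one more
   than the cells. *)
pose cell (j : 'I_(L ^ k).+1) : {ffun 'I_k -> 'I_L} :=
  [ffun i => Ordinal (cell_lt (x 0 i *+ j))].
have : ~~ injectiveb cell.
  apply/negP => /injectiveP/leq_card; rewrite card_ord card_ffun !card_ord.
  by rewrite ltnn.
move=> /injectivePn[j1 [j2 j12 ecell]].
wlog {j12} lt12 : j1 j2 ecell / (j1 < j2)%N.
  move=> wl; have [|/wl|] := ltngtP j1 j2; first exact: wl.
    by apply; rewrite ecell.
  by move=> /val_inj e; rewrite e eqxx in j12.
pose m : 'rV[int]_k := \row_i
  (Num.floor (x 0 i *+ j2) - Num.floor (x 0 i *+ j1)).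
pose y := x *+ (j2 - j1) - map_mx intr m.
have y0 : y = 0.
  apply: small.
    rewrite mulmxBl; apply: TB; last exact: lattice_int_comb.
    by rewrite -scaler_nat -scalemxAl scaler_nat pmulrn; exact: lattice_mulz.
  move=> i; have -> : y 0 i = frac (x 0 i *+ j2) - frac (x 0 i *+ j1).
    rewrite !mxE mulmxnE mulrnBr ?(ltnW lt12) // /frac intrB; lra.
  move/ffunP/(_ i): ecell; rewrite !ffunE => /(congr1 (@nat_of_ord _)) /= e.
  have {}e : Num.floor (frac (x 0 i *+ j1) * L%:R) = Num.floor (frac (x 0 i *+ j2) * L%:R).
    have f0 t : 0 <= Num.floor (frac t * L%:R) by rewrite floor_ge0 mulr_ge0 // ltW.
    by rewrite -(gez0_abs (f0 _)) e gez0_abs.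
  have /andP[] := floor_itv (frac (x 0 i *+ j1) * L%:R).
  have /andP[] := floor_itv (frac (x 0 i *+ j2) * L%:R).
  rewrite -e intrD => *; rewrite -(ler_pM2r L0) mulVf ?gt_eqF //.
  by rewrite -{1}(gtr0_norm L0) -normrM mulrBl ler_norml; apply/andP; split; lra.
(* (j2 - j1) x is integral, and j2 - j1 is at most L^k, so it divides the factorial. *)
move=> i; have /dvdnP[q ->] : (j2 - j1 %| (L ^ k)`!)%N.
  by apply: dvdn_fact; rewrite subn_gt0 lt12 leq_subLR; have := ltn_ord j2; lia.
rewrite mulnC mulrnA; apply: rpredMn.
have /rowP/(_ i) := y0; rewrite !mxE mulmxnE => /subr0_eq->.
exact: intr_int.
Qed.

(** The coordinates in a spanning family, cleared of their common denominator [N]; the floor is then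
    exact on [T], hence additive. *)
Lemma lattice_integer_coordinates : exists k (c : nat -> 'rV[R]_n -> int),
  (forall i, {in T &, {morph c i : u v / u + v}}) /\
  forall v, T v -> (forall i, (i < k)%N -> c i v = 0) -> v = 0.
Proof.
have [k [M [Mfree TM Tspan]]] := lattice_spanning_family.
have [N N0 Nint] := lattice_coordinates_rational Mfree TM.
have coordsK v : T v -> v *m pinvmx M *m M = v by move=> /Tspan/mulmxKpV.
have cint v i : T v -> (v *m pinvmx M) 0 i *+ N \is a Num.int.
  by move=> Tv; apply: Nint; rewrite coordsK.
exists k, (fun i v => if insub i is Some j
                      then Num.floor ((v *m pinvmx M) 0 (j : 'I_k) *+ N) else 0).
split=> [i u v /set_mem Tu /set_mem Tv|v Tv v0].
  case: insubP => [j _ _|_]; last by rewrite addr0.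
  by rewrite mulmxDl mxE mulrnDl floorDrz // cint.
rewrite -(coordsK v Tv) (_ : v *m _ = 0) ?mul0mx //; apply/rowP => j.
rewrite [RHS]mxE; have := v0 j (ltn_ord j); rewrite valK => /(congr1 (fun z : int => z%:~R : R)).
by rewrite floorK ?cint // => /eqP; rewrite mulrn_eq0 (gtn_eqF N0) => /eqP.
Qed.

End DiscreteLattices.

(** * Euclidean isometries and their translation lattices *)

Section IsometryAlgebra.
Variables (R : realType) (n : nat).
Implicit Types (g h : eisom R n) (v : 'cV[R]_n).
Local Notation L := (@linear_part R n).
Local Notation s := (@translation_part R n).

Lemma eisom_eq g h : L g = L h -> s g = s h -> g = h.
Proof.
case: g h => [[A a] pA] [[B b] pB]; rewrite /linear_part /translation_part /= => eA ea.
by apply/val_inj; rewrite /= eA ea.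
Qed.

Lemma linear_partM g h : L (g * h)%g = L g *m L h. Proof. by []. Qed.
Lemma linear_part1 : L 1%g = 1%:M. Proof. by []. Qed.
Lemma translation_partM g h : s (g * h)%g = L g *m s h + s g. Proof. by []. Qed.
Lemma translation_part1 : s 1%g = 0. Proof. by []. Qed.

Lemma linear_partV g : L g^-1%g = (L g)^T. Proof. by []. Qed.

Lemma linear_part_translation v : L (translation v) = 1%:M. Proof. by []. Qed.
Lemma translation_part_translation v : s (translation v) = v. Proof. by []. Qed.

#[local] Opaque eisom_mul eisom_inv translation linear_part translation_part.

Definition eisomE := (linear_partM, translation_partM, linear_part1, translation_part1,
  linear_part_translation, translation_part_translation).

Lemma translation0 : translation 0 = 1%g :> eisom R n.
Proof. by apply: eisom_eq; rewrite !eisomE. Qed.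

Lemma translationD u v :
  (translation u * translation v)%g = translation (u + v) :> eisom R n.
Proof. by apply: eisom_eq; rewrite !eisomE mul1mx // addrC. Qed.

Lemma translationV v : ((translation v)^-1)%g = translation (- v) :> eisom R n.
Proof.
by apply: (mulgI (translation v)); rewrite mulgV translationD subrr translation0.
Qed.

Lemma mul_translation g v :
  (g * translation v)%g = (translation (L g *m v) * g)%g.
Proof.
apply: eisom_eq; rewrite !eisomE.
  by rewrite mulmx1 mul1mx.
by rewrite mul1mx addrC.
Qed.

Lemma linear_part_eq1 g : L g = 1%:M -> g = translation (s g).
Proof. by move=> L1; apply: eisom_eq; rewrite !eisomE. Qed.

Lemma eisom_sqr g : L g *m L g = 1%:M -> (g * g)%g = translation ((1%:M + L g) *m s g).
Proof.
move=> gg; apply: eisom_eq; rewrite !eisomE //.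
by rewrite [RHS]mulmxDl mul1mx addrC.
Qed.

End IsometryAlgebra.

#[local] Opaque eisom_mul eisom_inv translation linear_part translation_part.

Section Lattice.
Variables (R : realType) (n : nat) (G : groupClosed (eisom R n)).
Local Notation L := (@linear_part R n).
Local Notation s := (@translation_part R n).

Definition lattice_vectors : set 'cV[R]_n := [set v | translation v \in G].
Local Notation T := lattice_vectors.

Lemma lattice_vectorsD u v : T u -> T v -> T (u + v).
Proof. by move=> Tu Tv; rewrite /T /= -translationD; exact: gpredM. Qed.

Lemma lattice_vectorsN v : T v -> T (- v).
Proof. by move=> Tv; rewrite /T /= -translationV gpredV. Qed.

Lemma lattice_vectors_stable g v : g \in G -> T v -> T (L g *m v).
Proof.
move=> Gg Tv; rewrite /T /=.
have -> : translation (L g *m v) = (g * translation v * g^-1)%g.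
  by rewrite mul_translation mulgK.
by apply: gpredF => //; exact: gpredM.
Qed.

Lemma lattice_subgroupE g : lattice_subgroup G g <-> g \in G /\ L g = 1%:M.
Proof.
split=> [[Gg [v _ e]]|[Gg L1]]; first by rewrite -e in Gg *; rewrite eisomE.
by split; [exact: Gg | exists (s g); [exact: I | exact/esym/linear_part_eq1]].
Qed.

(** The identity is isolated in [G], and a neighbourhood isolating it contains every translation by
    a vector with small entries. *)
Lemma discrete_lattice_vectors : discrete_subgroup G ->
  exists2 eps : R, 0 < eps & forall v, T v -> (forall i, `|v i 0| < eps) -> v = 0.
Proof.
move=> dG; have [_ [V [B [[C Cop <-] C1 CV]] VG]] := dG 1%g gpred1.
have nC : nbhs ((1%:M, 0) : 'M[R]_n * 'cV[R]_n) C by apply: open_nbhs_nbhs.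
have [[P Q] /= [nP nQ] PQC] := nC.
have /nbhs_ballP[e /= e0 eQ] := nQ.
exists e => // v Tv ve.
have : (V `&` [set` G]) (translation v).
  split=> //; apply: CV; apply: (PQC (1%:M, v)); split; first exact: nbhs_singleton nP.
  apply: eQ; split=> // i j; rewrite ord1 mxE /ball /= sub0r normrN.
  exact: ve.
rewrite VG => /(congr1 s) /=; exact.
Qed.

Lemma lattice_vectors_coordinates : discrete_subgroup G ->
  exists k (c : nat -> 'cV[R]_n -> int),
    (forall i, {in T &, {morph c i : u v / u + v}}) /\
    forall v, T v -> (forall i, (i < k)%N -> c i v = 0) -> v = 0.
Proof.
move=> /discrete_lattice_vectors[eps eps0 Tdiscr].
have [|u v Tu Tv|v Tv v_lt|k [c [cD cI]]] :=
  @lattice_integer_coordinates R n [set u | T u^T] eps eps0.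
- by rewrite /= trmx0 /T /= gpred1.
- by rewrite /= linearB; apply/lattice_vectorsD/lattice_vectorsN.
- by rewrite -[v]trmxK (Tdiscr v^T) ?trmx0 // => i; rewrite mxE.
exists k, (fun i v => c i v^T); split=> [i u v /set_mem Tu /set_mem Tv|v Tv cv].
  by rewrite linearD; apply: cD; apply/mem_set; rewrite /= trmxK.
by rewrite -[v]trmxK (cI v^T) ?trmx0 //= trmxK.
Qed.

Local Notation X := (subgroup_type G).

(* g |-> Q (s g) is a homomorphism on H; its double takes values in the
   lattice, because 2 Q (s g) = Q (1 + L g) (s g) and (1 + L g) (s g) is the
   translation g^2. *)
Lemma polyZ_translation_kernel (H : set X) (Q : 'M[R]_n) :
  discrete_subgroup G -> is_subgroup H ->
  (forall x, H x -> L (val x) *m L (val x) = 1%:M) ->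
  (forall v, T v -> T (Q *m v)) -> (forall x, H x -> Q *m L (val x) = Q) ->
  polyZ (H `&` [set x | Q *m s (val x) = 0]) -> polyZ H.
Proof.
move=> dG sH L2 QT QL pK; have [k [c [cD cI]]] := lattice_vectors_coordinates dG.
have TQ x : H x -> T (Q *m s (val x) *+ 2).
  move=> Hx; have -> : Q *m s (val x) *+ 2 = Q *m ((1%:M + L (val x)) *m s (val x)).
    by rewrite mulmxA mulmxDr mulmx1 QL // mulmxDl.
  by apply: QT; rewrite /T /= -eisom_sqr ?L2 //; apply: gpredM; exact: valP.
apply: (@polyZ_homs _ H k (fun i x => c i (Q *m s (val x) *+ 2))) => //.
  move=> i x y Hx Hy; rewrite -cD; try by apply/mem_set; exact: TQ.
  rewrite /= translation_partM mulmxDr mulmxA QL // -mulrnDl addrC //.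
have T0 : T 0 by rewrite /T /= translation0 gpred1.
congr polyZ: pK; apply/seteqP; split=> x [Hx /= Qx]; split=> //=.
  move=> i _; rewrite Qx mul0rn; apply: (addrI (c i 0)).
  by rewrite -cD ?addr0 //; exact: mem_set.
have /eqP := cI _ (TQ x Hx) Qx.
by rewrite -scaler_nat scaler_eq0 pnatr_eq0 => /eqP.
Qed.

Lemma polyZ_translations (H : set X) : discrete_subgroup G -> is_subgroup H ->
  (forall x, H x -> L (val x) = 1%:M) -> polyZ H.
Proof.
move=> dG sH L1; apply: (@polyZ_translation_kernel _ 1%:M) => //.
- by move=> x /L1->; rewrite mulmx1.
- by move=> v; rewrite mul1mx.
- by move=> x /L1->; rewrite mulmx1.
rewrite (_ : _ `&` _ = [set 1%g]); first exact: polyZ_trivial.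
apply/seteqP; split=> x; last by move=> ->; split; [exact: sH.1 | rewrite /= mulmx0].
move=> [/L1 Lx]; rewrite /= mul1mx => sx.
by apply/val_inj/eisom_eq.
Qed.

(** The two vanishing conditions say that [L b] negates the vector of the translation a^2 and [L a]
    that of b^2, which are the Promislow relations. *)
Lemma promislow_isometries (a b : eisom R n) :
  torsion_free X -> a \in G -> b \in G ->
  L a *m L a = 1%:M -> L b *m L b = 1%:M -> L a != 1%:M -> L b != 1%:M ->
  (1%:M + L b) *m (1%:M + L a) *m s a = 0 ->
  (1%:M + L a) *m (1%:M + L b) *m s b = 0 ->
  ~ unit_conjecture 'F_2 X.
Proof.
move=> tf Ga Gb a2 b2 a1 b1 ea eb.
have flip (g h : eisom R n) : L g *m L g = 1%:M ->
    (1%:M + L h) *m (1%:M + L g) *m s g = 0 ->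
    (h * (g * g) = (g * g)^-1 * h)%g.
  move=> g2 e; rewrite eisom_sqr // mul_translation translationV.
  congr (translation _ * h)%g; apply/eqP; rewrite -addr_eq0 addrC.
  by rewrite -[X in X + _]mul1mx -mulmxDl mulmxA e.
pose a' : X := exist _ a Ga; pose b' : X := exist _ b Gb.
apply: (@promislow_pair_not_unit_conjecture X a' b') => //.
- by apply: contra_neq a1 => /(congr1 val) /= ->.
- by apply: contra_neq b1 => /(congr1 val) /= ->.
- by apply: val_inj; rewrite /= flip.
- by apply: val_inj; rewrite /= flip.
Qed.

(** Here g^2 is the translation by 0, so g is torsion. *)
Lemma linear_part_sqrN1 (g : eisom R n) : torsion_free X -> g \in G ->
  L g *m L g = 1%:M -> (1%:M + L g) *m s g = 0 -> g = 1%g.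
Proof.
move=> tf Gg g2 sg; pose x : X := exist _ g Gg.
suff /(congr1 val) : x = 1%g by [].
by apply: (tf x 2%N) => //; apply: val_inj; rewrite /= eisom_sqr // sg.
Qed.

End Lattice.

(** * The holonomy group as a group of linear parts *)

Section Holonomy.
Variables (R : realType) (n : nat) (G : groupClosed (eisom R n)).
Local Notation L := (@linear_part R n).
Local Notation s := (@translation_part R n).

(** The kernel of [h] consists of the translations in [G], which are the elements with linear part
    1; so relations in [V] become matrix identities. *)
Lemma holonomy_hom (V : zmodType) : holonomy_isog G V ->
  exists h : eisom R n -> V, [/\ hom_on [set` G] h,
    forall x y, x \in G -> y \in G -> h x = h y <-> L x = L y &
    forall v, exists2 x, x \in G & h x = v].
Proof.
have sG := groupClosed_is_subgroup G.
have sN : is_subgroup (lattice_subgroup G).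
  split=> [|x y /lattice_subgroupE[Gx Lx] /lattice_subgroupE[Gy Ly]].
    by apply/lattice_subgroupE; split; [exact: gpred1 | exact: linear_part1].
  apply/lattice_subgroupE; split; first exact: gpredF.
  by rewrite linear_partM linear_partV Lx Ly trmx1 mulmx1.
move=> /(quotient_isog_hom sG sN)[].
  move=> x u Gx /lattice_subgroupE[Gu Lu]; apply/lattice_subgroupE; split.
    exact: gpredJ.
  by rewrite conjgE !linear_partM Lu mul1mx linear_partV eisom_orthl.
move=> h [hh kh hsurj]; exists h; split=> // x y Gx Gy.
have GVx : x^-1%g \in G by rewrite gpredV.
have -> : h x = h y <-> h (x^-1 * y)%g = 0.
  rewrite hh // (hom_onV sG hh) //; split=> [->|/eqP]; first by rewrite addNr.
  by rewrite addrC subr_eq0 => /eqP.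
rewrite kh; last exact: gpredM.
rewrite lattice_subgroupE linear_partM linear_partV; split=> [[_ e]|e].
  by rewrite -[L x]mulmx1 -e mulmxA eisom_orthr mul1mx.
by split; [exact: gpredM | rewrite e eisom_orthl].
Qed.

Lemma char2_row k (v : 'rV['F_2]_k) : v + v = 0.
Proof. by apply/rowP => i; rewrite !mxE; apply/val_inj; case: (v 0 i) => [[|[|]]]. Qed.

Variables (k : nat) (h : eisom R n -> 'rV['F_2]_k).
Hypotheses (hh : hom_on [set` G] h)
  (hL : forall x y, x \in G -> y \in G -> h x = h y <-> L x = L y).

Lemma holonomy_sqr g : g \in G -> L g *m L g = 1%:M.
Proof.
move=> Gg; rewrite -linear_partM -linear_part1.
apply/hL; [exact: gpredM | exact: gpred1 |].
by rewrite hh // char2_row (hom_on1 (groupClosed_is_subgroup G) hh).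
Qed.

Lemma holonomy_comm g g' : g \in G -> g' \in G -> L g *m L g' = L g' *m L g.
Proof.
move=> Gg Gg'; rewrite -!linear_partM.
by apply/hL; [exact: gpredM | exact: gpredM | rewrite !hh // addrC].
Qed.

End Holonomy.

(** * Bieberbach groups with holonomy C_2^2 *)

Local Notation L := (@linear_part _ _).
Local Notation s := (@translation_part _ _).

Theorem klein_holonomy (R : realType) (n : nat) (G : groupClosed (eisom R n)) :
  bieberbach G -> holonomy_isog G 'rV['F_2]_2 ->
  ~ unit_conjecture 'F_2 (subgroup_type G) \/ poly_Z (subgroup_type G).
Proof.
move=> [[dG _] tf] /holonomy_hom[h [hh hL hsurj]].
have sG := groupClosed_is_subgroup G.
have L2 := holonomy_sqr hh hL; have LC := holonomy_comm hh hL.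
pose e1 : 'rV['F_2]_2 := delta_mx 0 0; pose e2 : 'rV['F_2]_2 := delta_mx 0 1.
have V4 v : [\/ v = 0, v = e1, v = e2 | v = e1 + e2].
  have v01 (z : 'F_2) : z = 0 \/ z = 1.
    by case: z => [[|[|//]] lz]; [left | right]; exact: val_inj.
  have -> : v = v 0 0 *: e1 + v 0 1 *: e2.
    rewrite [LHS]row_sum_delta !big_ord_recl big_ord0 addr0.
    by rewrite (_ : lift ord0 ord0 = 1 :> 'I_2); last exact: val_inj.
  case: (v01 (v 0 0)) (v01 (v 0 1)) => -> [] ->;
    rewrite ?scale0r ?scale1r ?add0r ?addr0;
    [exact: Or41 | exact: Or43 | exact: Or42 | exact: Or44].
have [a0 Ga0 ha0] := hsurj e1; have [b0 Gb0 hb0] := hsurj e2.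
(* As A and B are commuting involutions, Q is four times the projection onto the subspace fixed by
   the holonomy; the factor four makes it preserve the lattice. *)
pose A := L a0; pose B := L b0; pose Q := (1%:M + A) *m (1%:M + B).
have absorb (W : 'M[R]_n) : W *m W = 1%:M -> (1%:M + W) *m W = 1%:M + W.
  by move=> W2; rewrite mulmxDl mul1mx W2 addrC.
have QB : Q *m B = Q by rewrite -mulmxA absorb // L2.
have QE : Q = (1%:M + B) *m (1%:M + A).
  by rewrite /Q !mulmxDl !mulmxDr !mul1mx !mulmx1 [A *m B]LC // addrACA.
have QA : Q *m A = Q by rewrite QE -mulmxA absorb // L2.
have QL g : g \in G -> Q *m L g = Q.
  move=> Gg; have h0 := hom_on1 sG hh.
  case: (V4 (h g)) => hg.
  - have -> : L g = L 1%g by apply/hL; rewrite ?gpred1 // h0.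
    by rewrite mulmx1.
  - by have -> : L g = A by apply/hL; rewrite // ha0.
  - by have -> : L g = B by apply/hL; rewrite // hb0.
  have -> : L g = L (a0 * b0)%g by apply/hL; rewrite ?gpredM // hh // ha0 hb0.
  by rewrite linear_partM mulmxA QA QB.
have T1 g v : g \in G -> lattice_vectors G v ->
    lattice_vectors G ((1%:M + L g) *m v).
  move=> Gg Tv; rewrite mulmxDl mul1mx.
  by apply: lattice_vectorsD => //; exact: lattice_vectors_stable.
pose K : set (subgroup_type G) := [set x | Q *m s (val x) = 0].
have sK : is_subgroup K.
  have hf : hom_on [set: subgroup_type G] (fun x => Q *m s (val x)).
    move=> x y _ _; rewrite /= translation_partM mulmxDr mulmxA QL; first exact: addrC.
    exact: valP.
  have sT : is_subgroup [set: subgroup_type G] by split.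
  have := hom_on_ker_subgroup sT hf.
  by rewrite setTI.
(* If K has holonomy inside {0, w}, take the kernel K of the translation along Q, then inside K the
   kernel of the translation along 1 + L gw. What is left consists of translations. *)
have cyclic_holonomy w :
    (forall x, K x -> h (val x) = 0 \/ h (val x) = w) -> polyZ [set: subgroup_type G].
  move=> Kw; have [gw Ggw hgw] := hsurj w.
  have LK x : K x -> L (val x) = 1%:M \/ L (val x) = L gw.
    move=> /Kw[hx|hx]; [left | right]; last by apply/hL; rewrite ?hx ?hgw //; exact: valP.
    rewrite -(linear_part1 R n); apply/hL; rewrite ?gpred1 ?hx ?(hom_on1 sG hh) //.
    exact: valP.
  apply: (polyZ_translation_kernel (Q := Q)) => //.
  - by move=> x _; apply: L2; exact: valP.
  - by move=> v Tv; rewrite -mulmxA; apply/T1/T1.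
  - by move=> x _; apply: QL; exact: valP.
  rewrite setTI -/K.
  have QwL x : K x -> (1%:M + L gw) *m L (val x) = 1%:M + L gw.
    by move=> /LK[->|->]; rewrite ?mulmx1 // absorb // L2.
  apply: (polyZ_translation_kernel (Q := 1%:M + L gw)) => //.
  - by move=> x _; apply: L2; exact: valP.
  - by move=> v; exact: T1.
  have hw : hom_on K (fun x => (1%:M + L gw) *m s (val x)).
    by move=> x y Kx Ky; rewrite /= translation_partM mulmxDr mulmxA QwL // addrC.
  apply: polyZ_translations => //; first exact: (hom_on_ker_subgroup sK hw).
  move=> x [Kx /= sx]; have [//|Lx] := LK x Kx.
  (* An element of this kernel with linear part L gw has trivial square, hence is the identity. *)
  rewrite (linear_part_sqrN1 tf (valP x)) ?linear_part1 ?L2 //; first exact: valP.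
  by rewrite Lx.
(* If K misses e, it cannot attain both e' and e + e', whose sum is e; so its holonomy is cyclic. *)
have missing e e' : (forall v, [\/ v = 0, v = e, v = e' | v = e + e']) ->
    ~ (exists x, K x /\ h (val x) = e) -> polyZ [set: subgroup_type G].
  move=> Vee' noe.
  have [[y [Ky hy]]|noee'] := pselect (exists y, K y /\ h (val y) = e + e').
    apply: (cyclic_holonomy (e + e')) => x Kx.
    case: (Vee' (h (val x))) => hx; [by left | by case: noe; exists x | | by right].
    case: noe; exists (x * y)%g; split; first exact: is_subgroupM.
    by rewrite /= hh ?hx ?hy ?addrA; [rewrite addrAC char2_row add0r | exact: valP ..].
  apply: (cyclic_holonomy e') => x Kx.
  case: (Vee' (h (val x))) => hx; [by left | by case: noe; exists x | by right |].
  by case: noee'; exists x.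
have [[a [Ka ha]]|noa] := pselect (exists a, K a /\ h (val a) = e1); last first.
  by right; apply/polyZ_poly_Z/(missing e1 e2).
have [[b [Kb hb]]|nob] := pselect (exists b, K b /\ h (val b) = e2); last first.
  right; apply/polyZ_poly_Z/(missing e2 e1) => // v.
  by case: (V4 v); [exact: Or41 | exact: Or43 | exact: Or42 | rewrite addrC; exact: Or44].
left.
  have Ga := valP a; have Gb := valP b.
  have LA : L (val a) = A by apply/hL; rewrite // ha.
  have LB : L (val b) = B by apply/hL; rewrite // hb.
  have neq1 g : g \in G -> h g != 0 -> L g != 1%:M.
    move=> Gg; apply: contra_neq => Lg.
    by rewrite -(hom_on1 sG hh); apply/hL; rewrite ?gpred1.
  (* Since Q is the product of 1 + A and 1 + B in either order, membership of a and b in K is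
     exactly the pair of vanishing conditions. *)
  apply: (promislow_isometries tf Ga Gb); rewrite ?L2 ?neq1 ?ha ?hb //.
  + by apply/eqP => /rowP/(_ 0); rewrite !mxE.
  + by apply/eqP => /rowP/(_ 1); rewrite !mxE.
  + by rewrite LA LB -QE.
  + by rewrite LA LB.
Qed.

(** * Hantzsche-Wendt groups *)

Section SignVectors.
Variables (R : numDomainType) (n : nat).
Implicit Types f : {ffun 'I_n.+1 -> bool}.

Definition det1_signs : {set {ffun 'I_n.+1 -> bool}} :=
  [set f : {ffun 'I_n.+1 -> bool} | \prod_i (-1) ^+ (f i) == 1 :> R].

(** Changing one fixed sign maps these vectors injectively into their complement, so they are at
    most half of all sign vectors. *)
Lemma card_det1_signs : (#|det1_signs| <= 2 ^ n)%N.
Proof.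
pose flip0 f : {ffun 'I_n.+1 -> bool} := [ffun i => (i == ord0) (+) f i].
have flip0K : involutive flip0 by move=> f; apply/ffunP => i; rewrite !ffunE addbA addbb.
have sub : flip0 @: det1_signs \subset ~: det1_signs.
  apply/fintype.subsetP => _ /imsetP[f + ->]; rewrite !inE (bigD1 ord0) //= => /eqP f1.
  rewrite (bigD1 ord0) //= ffunE eqxx.
  rewrite (eq_bigr (fun i => (-1) ^+ (f i))); last first.
    by move=> i i0; rewrite ffunE (negbTE i0).
  rewrite signrN mulNr f1 eq_sym -subr_eq0 opprK -mulr2n pnatr_eq0 //.
have := subset_leq_card sub; rewrite (card_imset _ (inv_inj flip0K)).
have := cardsC det1_signs; rewrite card_ffun card_ord card_bool expnS.
by set a := #|_|; set b := #|_|; lia.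
Qed.

End SignVectors.

Theorem hantzsche_wendt_not_unit_conjecture (R : realType) (m : nat)
    (G : groupClosed (eisom R m.+2)) :
  hantzsche_wendt G -> ~ unit_conjecture 'F_2 (subgroup_type G).
Proof.
move=> [_ [[dG _] tf] orient /holonomy_hom[h [hh hL hsurj]]].
have sG := groupClosed_is_subgroup G.
have L2 := holonomy_sqr hh hL; have LC := holonomy_comm hh hL.
have /choice[g gP] : forall v, exists g, g \in G /\ h g = v.
  by move=> v; have [g Gg hg] := hsurj v; exists g.
have Gg v : g v \in G by have [] := gP v.
(* The linear parts commute and are annihilated by (X - 1) (X + 1), so one change of basis
   diagonalizes them all. *)
have [P Pu /allP Pdiag] : codiagonalizable [seq L (g v) | v <- enum {: 'rV['F_2]_m.+1}].
  apply/codiagonalizableP; split.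
    by move=> _ _ /mapP[v _ ->] /mapP[w _ ->]; exact: LC.
  move=> _ /mapP[v _ ->]; apply/diagonalizableP; exists [:: 1; -1].
    by rewrite /= inE andbT -subr_eq0 opprK -mulr2n pnatr_eq0.
  apply: mxminpoly_min; rewrite big_cons big_seq1 rmorphM /= !rmorphB /=.
  rewrite horner_mx_X !horner_mx_C.
  change ((L (g v) - 1%:M) *m (L (g v) - (-1)%:M) = 0).
  by rewrite raddfN opprK mulmxDr mulmx1 mulmxBl mul1mx L2 // addrA subrK subrr.
have [D defD] : exists D, forall v, D v = P *m L (g v) *m invmx P.
  by exists (fun v => P *m L (g v) *m invmx P).
have DK v : L (g v) = invmx P *m D v *m P by rewrite defD !mulmxA mulVmx // mul1mx mulmxKV.
have Ddiag v i j : i != j -> D v i j = 0.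
  move=> ij; have : L (g v) \in [seq L (g v) | v <- enum {: 'rV['F_2]_m.+1}].
    by apply: map_f; rewrite mem_enum.
  by rewrite defD; move/Pdiag => /(diagonalizable_forP _ Pu); apply.
have D2 v : D v *m D v = 1%:M.
  by rewrite !defD !mulmxA mulmxKV // -(mulmxA P) L2 // mulmx1 mulmxV.
pose sign v : {ffun 'I_m.+2 -> bool} := [ffun i => D v i i == -1].
have DE v : D v = diag_mx (\row_i (-1) ^+ (sign v i)).
  apply/matrixP => i j; rewrite !mxE ffunE; have [<-|ij] := eqVneq i j; last first.
    by rewrite mulr0n Ddiag.
  rewrite mulr1n; have /matrixP/(_ i i) := D2 v.
  rewrite !mxE (bigD1 i) //= big1 => [|l li]; last by rewrite Ddiag ?mul0r // eq_sym.
  rewrite addr0 eqxx -expr2 => /eqP; rewrite sqrf_eq1.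
  case/orP => /eqP->; last by rewrite eqxx.
  by rewrite -subr_eq0 opprK -mulr2n pnatr_eq0.
have sign_inj : injective sign.
  move=> v w vw; have [_ <-] := gP v; have [_ <-] := gP w.
  by apply/hL => //; rewrite !DK !DE vw.
(* The 2^(m+1) holonomy elements have distinct sign vectors of product 1, and there are no more such
   vectors. *)
have signE : sign @: {: 'rV['F_2]_m.+1} = det1_signs R m.+1.
  apply/eqP; rewrite eqEcard card_imset // card_mx card_Fp // mul1n.
  rewrite card_det1_signs andbT; apply/fintype.subsetP => _ /imsetP[v _ ->].
  rewrite inE; have := orient _ (Gg v); rewrite DK !det_mulmx mulrC mulrA -det_mulmx.
  rewrite mulmxV // det1 mul1r DE det_diag => /eqP.
  by under eq_bigr do rewrite mxE.
have realize (f : {ffun 'I_m.+2 -> bool}) : \prod_i (-1) ^+ (f i) = 1 :> R -> exists v, sign v = f.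
  move=> f1; have : f \in sign @: {: 'rV['F_2]_m.+1} by rewrite signE inE f1.
  by case/imsetP => v _ ->; exists v.
have prod_but (i : 'I_m.+2) : \prod_j (-1) ^+ (j != i) = (-1) ^+ m.+1 :> R.
  rewrite (bigD1 i) //= eqxx mul1r (eq_bigr (fun=> -1)).
    by rewrite prodr_const cardC1 card_ord.
  by move=> j ->.
(* In even dimension -1 has determinant 1 and is thus a linear part; its element has trivial square,
   which is impossible. *)
case: (boolP (odd m)) => [oddm|evenm]; last first.
  have [v sv] : exists v, sign v = [ffun=> true].
    apply: realize; under eq_bigr do rewrite ffunE.
    by rewrite prodr_const card_ord expr1 -signr_odd /= negbK (negbTE evenm).
  have Dv : D v = - 1%:M.
    by rewrite DE sv; apply/matrixP => i j; rewrite !mxE ffunE mulNrn.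
  have Lv : L (g v) = - 1%:M by rewrite DK Dv mulmxN mulmx1 mulNmx mulVmx.
  have gv1 : g v = 1%g.
    by apply: (linear_part_sqrN1 tf) => //; [exact: L2 | rewrite Lv subrr mul0mx].
  move: Lv; rewrite gv1 linear_part1 => /matrixP/(_ 0 0) /eqP.
  by rewrite !mxE eqxx -subr_eq0 opprK -mulr2n pnatr_eq0.
(* Elements fixing only the first, respectively only the last, coordinate; they have m + 1 signs -1,
   an even number. *)
have [v1 s1] : exists v, sign v = [ffun j => j != ord0].
  apply: realize; under eq_bigr do rewrite ffunE.
  by rewrite prod_but -signr_odd /= oddm.
have [v2 s2] : exists v, sign v = [ffun j => j != ord_max].
  apply: realize; under eq_bigr do rewrite ffunE.
  by rewrite prod_but -signr_odd /= oddm.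
have L1D v : 1%:M + L (g v) = invmx P *m (1%:M + D v) *m P.
  by rewrite mulmxDr mulmx1 mulmxDl mulVmx // -DK.
(* Both factors are twice the projection onto a coordinate line, and the two lines differ. *)
have D12 : (1%:M + D v1) *m (1%:M + D v2) = 0 /\ (1%:M + D v2) *m (1%:M + D v1) = 0.
  have e v : 1%:M + D v = diag_mx (\row_i (1 + (-1) ^+ (sign v i))).
    by rewrite DE; apply/matrixP => i j; rewrite !mxE -mulrnDl.
  rewrite !e !mulmx_diag s1 s2; split; apply/matrixP => i j; rewrite !mxE !ffunE;
    by case: (eqVneq i ord0) => [->|_]; rewrite ?subrr ?mulr0 ?mul0r ?mul0rn.
have L12 v w : (1%:M + D v) *m (1%:M + D w) = 0 -> (1%:M + L (g v)) *m (1%:M + L (g w)) = 0.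
  move=> e; rewrite !L1D !mulmxA mulmxK // -(mulmxA (invmx P)) e.
  by rewrite mulmx0 mul0mx.
have Lneq1 v i : sign v i -> L (g v) != 1%:M.
  move=> si; apply/eqP => Lv; have : D v i i = 1 by rewrite !defD Lv mulmx1 mulmxV // mxE eqxx.
  by rewrite DE !mxE eqxx si => /eqP; rewrite -subr_eq0 -opprD oppr_eq0 -mulr2n pnatr_eq0.
apply: (promislow_isometries tf (Gg v1) (Gg v2)); rewrite ?L2 //.
- by apply: (Lneq1 v1 ord_max); rewrite s1 ffunE.
- by apply: (Lneq1 v2 ord0); rewrite s2 ffunE.
- by rewrite L12 ?mul0mx //; case: D12.
- by rewrite L12 ?mul0mx //; case: D12.
Qed.


(** The holonomy group is trivial, so all elements are translations. *)
Lemma hantzsche_wendt_dim1 (R : realType) (G : groupClosed (eisom R 1)) :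
  hantzsche_wendt G -> poly_Z (subgroup_type G).
Proof.
move=> [_ [[dG _] _] _ /holonomy_hom[h [_ hL _]]].
apply/polyZ_poly_Z/polyZ_translations => //.
move=> x _; suff : L (val x) = L 1%g by rewrite linear_part1.
by apply/hL; [exact: valP | exact: gpred1 | rewrite [LHS]thinmx0 [RHS]thinmx0].
Qed.

Theorem corollary1p8 (R : realType) (n : nat) (G : groupClosed (eisom R n)) :
  hantzsche_wendt G \/
    [/\ bieberbach G, diagonal_type G & holonomy_isog G 'rV['F_2]_2] ->
  (unit_conjecture 'F_2 (subgroup_type G) <-> poly_Z (subgroup_type G)).
Proof.
move=> hG; split; last exact: poly_Z_unit_conjecture.
case: hG => [HW|[bG _ holG]] UC; last by case: (klein_holonomy bG holG).
(* Dimension 0 is excluded by definition, in dimension 1 the group is poly-Z, and from dimension 2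
   on the Unit Conjecture fails. *)
case: n => [|[|m]] in G HW UC *; first by case: HW.
  exact: hantzsche_wendt_dim1.
by case: (hantzsche_wendt_not_unit_conjecture HW UC).
Qed.
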